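(* Let $a,b\in K$ satisfy $0<|a|<1$ and $|b|=q$, let $T:K^2\to K^2$ be $T(x,y)=(ay+b(x^q-x),\,x)$, let $\mathcal{B}_T=\bigcup_{n\ge1}T^{-n}(R^2)$, and let $\mu_T$ be the unit Borel measure on $K^2$ defined in the context. There exists a subset $G\subseteq\mathcal{B}_T$ of full Haar measure in $\mathcal{B}_T$ (that is, $\mathcal{B}_T\setminus G$ has Haar measure zero) such that, for all $(x,y)\in G$, the forward orbit $\{T^n(x,y)\}_{n=0}^{\infty}$ is $\mu_T$-equidistributed. In particular, $\mu_T$ is a physical measure with respect to $T$.
   Context: $K$ is a field that is complete and locally compact with respect to a nontrivial non-Archimedean absolute value $|\cdot|$. $R=\{x\in K: |x|\le 1\}$ is its ring of integers, $\pi\in R$ is a uniformizing parameter, $\mathbb{F}=R/\pi R$ is the (finite) residue field, and $q=|\mathbb{F}|$. The absolute value is normalized so that $|\pi|=1/q$. For $s\in\mathbb{F}$, $D_{1/q}(s)=\{x\in R: x \bmod \pi = s\}$, a disc of radius $1/q$ in $R$. The map $T$ is a bijection of $K^2$ with inverse $T^{-1}(x,y)=(y,\frac1a(x-b(y^q-y)))$, and $T(R^2)\subseteq R^2$. Put $\mathcal{A}_T=\bigcap_{n\ge1}T^n(R^2)$. $\mathbb{F}^{\mathbb{Z}}$ is the set of bisequences $(s_k)_{k\in\mathbb{Z}}$, $s_k\in\mathbb{F}$, with the product topology, $\sigma$ is the shift map on it (the $k$-th term of $\sigma((s_k))$ is $s_{k+1}$), and $\mu_\sigma$ is the uniform Bernoulli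 measure, i.e. the Borel probability measure assigning measure $1/q^{2M+1}$ to each cylinder set $\{(s_k): s_k=t_k \text{ for all } |k|\le M\}$ ($M\ge0$, $t_{-M},\dots,t_M\in\mathbb{F}$). Definition of $\omega$ and $\mu_T$: for each $\mathbf{s}=(s_k)\in\mathbb{F}^{\mathbb{Z}}$ there is a unique point $\omega(\mathbf{s})\in\mathcal{A}_T$ such that $T^k(\omega(\mathbf{s}))\in D_{1/q}(s_k)\times R$ for all $k\ge0$ and $T^{k+1}(\omega(\mathbf{s}))\in R\times D_{1/q}(s_k)$ for all $k\le-1$; the resulting map $\omega:\mathbb{F}^{\mathbb{Z}}\to\mathcal{A}_T$ is a homeomorphism with $\omega\circ\sigma=T\circ\omega$. The measure $\mu_T$ is the pushforward $\mu_T(A)=\mu_\sigma(\omega^{-1}(A))$ for Borel $A\subseteq K^2$. For a unit Borel measure $\mu$ on $K^2$, the forward orbit of $(x,y)\in K^2$ is $\mu$-equidistributed if for all continuous $F:K^2\to\mathbb{R}$, $\lim_{N\to+\infty}\frac1N\sum_{n=0}^{N-1}F(T^n(x,y))=\int F\,d\mu$. A $T$-invariant unit Borel measure $\mu$ on $K^2$ is a physical measure with respect to $T$ if there exists a set $G\subseteq K^2$ of positive Haar measure such that every point of $G$ has $\mu$-equidistributed forward orbit. Haar measure is that of the additive group $K^2$. *)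

(* Defs.v *)
From HB Require Import structures.
From mathcomp Require Import all_boot all_order all_algebra finmap.
From mathcomp Require Import generic_quotient ring_quotient.
From mathcomp Require Import all_classical all_reals all_analysis.

Set Implicit Arguments.
Unset Strict Implicit.
Unset Printing Implicit Defensive.
Import Order.TTheory GRing.Theory Num.Theory.
Import numFieldNormedType.Exports.

Local Open Scope classical_set_scope.
Local Open Scope ring_scope.

(* absv is real-valued, so this is not a normed module over a numDomainType.   *)
(* The library has no join of PseudoMetric or Pointed with additive structures *)
(* below PseudoMetricNormedZmod (whose norm cannot be non-Archimedean), so the *)
(* metric is given through the entourages, and completeness without lim.       *)
HB.mixin Record isNonArchLocalField (R : realType) K
    of GRing.Field K & Uniform K := {
  absv : K -> R ;
  absv_ge0 : forall x : K, 0 <= absv x ;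
  absv_eq0 : forall x : K, absv x = 0 <-> x = 0 ;
  absvM : forall x y : K, absv (x * y) = absv x * absv y ;
  absvD : forall x y : K, absv (x + y) <= Num.max (absv x) (absv y) ;
  absv_nontrivial : exists x : K, x <> 0 /\ absv x <> 1 ;
  absv_entourage :
    entourage = entourage_ (fun (x : K) (e : R) => [set y | absv (x - y) < e]) ;
  absv_complete : forall F : set_system K,
    ProperFilter F -> cauchy F -> exists l : K, F --> l ;
  absv_locally_compact : locally_compact [set: K]
}.

#[short(type="nonArchLocalFieldType")]
HB.structure Definition NonArchLocalField (R : realType) :=
  {K of isNonArchLocalField R K & GRing.Field K & Uniform K}.

Section ring_of_integers.
Context {R : realType} (K : nonArchLocalFieldType R).

Definition integers_pred : {pred K} := [pred x : K | absv x <= 1].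

Lemma absv1 : absv (1 : K) = 1.
Proof.
have n0 : absv (1 : K) != 0 by apply/eqP => /absv_eq0/eqP; rewrite oner_eq0.
by apply: (mulfI n0); rewrite -absvM !mulr1.
Qed.

Lemma absvN1 : absv (-1 : K) = 1.
Proof.
have : absv (-1 : K) ^+ 2 == 1 by rewrite expr2 -absvM mulrNN mulr1 absv1.
rewrite sqrf_eq1 => /orP[/eqP//|/eqP h].
by have := absv_ge0 (-1 : K); rewrite h lerNr oppr0 ler10.
Qed.

Lemma integers_subring_closed : subring_closed integers_pred.
Proof.
split; rewrite /integers_pred.
- by rewrite inE absv1.
- move=> x y; rewrite !inE => hx hy.
  rewrite (le_trans (absvD _ _))// ge_max hx/= -mulN1r absvM absvN1 mul1r.
  exact: hy.
- move=> x y; rewrite !inE => hx hy.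
  by rewrite absvM mulr_ile1 ?absv_ge0.
Qed.

HB.instance Definition _ :=
  GRing.isSubringClosed.Build K integers_pred integers_subring_closed.

Record integers := Integers {
  integers_val :> K ;
  integersP : integers_val \in integers_pred
}.

HB.instance Definition _ := [isSub for integers_val].
HB.instance Definition _ := [Choice of integers by <:].
HB.instance Definition _ :=
  [SubChoice_isSubComNzRing of integers by <:].

Record uniformizer := Uniformizer {
  unif :> integers ;
  unif_neq0 : unif <> 0 ;
  unif_lt1 : absv (unif : K) < 1 ;
  unif_max : forall x : K, absv x < 1 -> absv x <= absv (unif : K)
}.

Definition unif_ideal (pi : uniformizer) : {pred integers} :=
  [pred x | `[< exists y : integers, x = (pi : integers) * y >] ].

Lemma unif_idealP (pi : uniformizer) (x : integers) :
  reflect (exists y : integers, x = (pi : integers) * y) (x \in unif_ideal pi).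
Proof. by rewrite inE /=; apply: (iffP (asboolP _)). Qed.

Lemma unif_ideal_closed (pi : uniformizer) : idealr_closed (unif_ideal pi).
Proof.
split.
- by apply/unif_idealP; exists 0; rewrite mulr0.
- apply/unif_idealP => -[y h1].
  have {}h1 := congr1 (@integers_val) h1.
  have := unif_lt1 pi; apply/negP; rewrite -leNgt.
  have <- : absv (integers_val 1) = 1 by rewrite absv1.
  rewrite h1 absvM; apply: ler_piMr; first exact: absv_ge0.
  by have := integersP y; rewrite inE.
- move=> c x y /unif_idealP[x' ->] /unif_idealP[y' ->].
  by apply/unif_idealP; exists (c * x' + y'); rewrite mulrDr mulrCA.
Qed.

HB.instance Definition _ (pi : uniformizer) :=
  isIdealr.Build integers (unif_ideal pi) (unif_ideal_closed pi).

End ring_of_integers.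

Section residue_field.
Context {R : realType} {K : nonArchLocalFieldType R} (pi : uniformizer K).

Definition residue_field := {ideal_quot (unif_ideal pi)}.

HB.instance Definition _ := GRing.ComNzRing.on residue_field.
HB.instance Definition _ := isPointed.Build residue_field 0.

Definition reduction (x : integers K) : residue_field :=
  \pi_({ideal_quot (unif_ideal pi)})%qT x.

(* fset_set is the junk value fset0 on infinite sets, but local compactness of *)
(* K makes the residue field finite.                                           *)
Definition residue_card : nat :=
  #|` fset_set (classical_sets.setT : set residue_field)|%fset.

Definition residue_disc (s : residue_field) : set K :=
  [set x | exists r : integers K, (r : K) = x /\ reduction r = s].

End residue_field.

(* K carries no pointedType structure, which the measurable structure below    *)
(* needs, hence the alias of K * K.                                            *)
Definition plane {R : realType} (K : nonArchLocalFieldType R) : Type :=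
  (K * K)%type.

HB.instance Definition _ (R : realType) (K : nonArchLocalFieldType R) :=
  GRing.Zmodule.copy (plane K) (K * K)%type.
HB.instance Definition _ (R : realType) (K : nonArchLocalFieldType R) :=
  Uniform.copy (plane K) (K * K)%type.
HB.instance Definition _ (R : realType) (K : nonArchLocalFieldType R) :=
  isPointed.Build (plane K) (0 : K, 0 : K).

Definition borel (T : ptopologicalType) := g_sigma_algebraType (@open T).

Section haar.
Context {R : realType} {K : nonArchLocalFieldType R}.

(* Regularity is not required: it is automatic, K^2 being locally compact and  *)
(* second countable.                                                           *)
Definition haar_measure
    (lambda : {measure set (borel (plane K)) -> \bar R}) : Prop :=
  [/\ lambda setT <> 0%E,
      (forall A : set (plane K), compact A -> (lambda A < +oo)%E) &
      (forall (A : set (borel (plane K))) (v : plane K), measurable A ->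
         lambda [set v + p | p in (A : set (plane K))] = lambda A)].

End haar.

Section symbolic.
Context {R : realType} {K : nonArchLocalFieldType R} (pi : uniformizer K).

Definition bisequence : Type :=
  {ptws int -> discrete_topology (residue_field pi)}.

HB.instance Definition _ := Topological.copy bisequence
  {ptws int -> discrete_topology (residue_field pi)}.
HB.instance Definition _ := isPointed.Build bisequence (fun=> 0 : residue_field pi).

Definition cylinder (M : nat) (t : bisequence) : set bisequence :=
  [set s : bisequence | forall k : int, (absz k <= M)%N -> s k = t k].

Definition uniform_bernoulli (mu : probability (borel bisequence) R) : Prop :=
  forall (M : nat) (t : bisequence),
    mu (cylinder M t) = ((residue_card pi)%:R ^- (2 * M + 1))%:E.

End symbolic.

Section henon.
Context {R : realType} {K : nonArchLocalFieldType R} (pi : uniformizer K).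
Variables a b : K.
Local Notation q := (residue_card pi).

Definition T_map (p : plane K) : plane K :=
  (a * p.2 + b * (p.1 ^+ q - p.1), p.1).

Definition T_inv (p : plane K) : plane K :=
  (p.2, a^-1 * (p.1 - b * (p.2 ^+ q - p.2))).

Definition T_pow (k : int) : plane K -> plane K :=
  match k with
  | Posz n => iter n T_map
  | Negz n => iter n.+1 T_inv
  end.

Definition integral_square : set (plane K) :=
  [set p | absv p.1 <= 1 /\ absv p.2 <= 1].

Definition attractor : set (plane K) :=
  \bigcap_(n in [set n | (1 <= n)%N]) (iter n T_map @` integral_square).

Definition basin : set (plane K) :=
  \bigcup_(n in [set n | (1 <= n)%N]) (iter n T_map @^-1` integral_square).

Definition coded_by (s : bisequence pi) (p : plane K) : Prop :=
  [/\ attractor p,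
      (forall k : int, 0 <= k ->
         residue_disc (s k) (T_pow k p).1 /\ absv (T_pow k p).2 <= 1) &
      (forall k : int, k <= -1 ->
         absv (T_pow (k + 1) p).1 <= 1 /\
         residue_disc (s k) (T_pow (k + 1) p).2)].

Definition omega (s : bisequence pi) : plane K := xget (0, 0) (coded_by s).

End henon.

Section physical.
Context {R : realType} {K : nonArchLocalFieldType R}.
Implicit Types (mu : probability (borel (plane K)) R) (T : plane K -> plane K).

(* Integrability is part of the definition because F need not be bounded.      *)
Definition equidistributed mu T (p : plane K) : Prop :=
  forall F : plane K -> R, continuous F ->
    mu.-integrable setT (EFin \o F) /\
    (N%:R^-1 * \sum_(n < N) F (iter n T p)) @[N --> \oo]
      --> (\int[mu]_x F x : R).

Definition invariant_measure mu T : Prop :=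
  forall A : set (borel (plane K)), measurable A -> mu (T @^-1` A) = mu A.

Definition physical_measure
    (lambda : {measure set (borel (plane K)) -> \bar R}) mu T : Prop :=
  invariant_measure mu T /\
  exists G : set (borel (plane K)),
    [/\ measurable G, (0 < lambda G)%E &
        forall p : plane K, G p -> equidistributed mu T p].

End physical.

(* Main.v *)
(* Write the orbit of (x, y) as T^n (x, y) = (x_n, x_(n-1)). The recurrence    *)
(*   x_n = x_n^q - b^-1 (x_(n+1) - a x_(n-1))                                 *)
(* has a right-hand side that contracts by 1/q on each residue disc, because  *)
(* |x^q - x'^q| <= |x - x'| / q there. Hence every itinerary in F^Z is        *)
(* realized by exactly one full orbit in R^2, and two orbits whose digits     *)
(* agree on a window of radius M agree up to q^-M in its middle: T^n p is     *)
(* close to omega of any bisequence that agrees with the digits of p near n.  *)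
(*                                                                            *)
(* The same estimate shows that, the second coordinate being fixed modulo     *)
(* pi^N, the first N digits of the orbit determine the first coordinate       *)
(* modulo pi^N. So each word of length N occurs on a set of Haar measure at   *)
(* most q^-N, and an Azuma-type bound together with Borel-Cantelli makes the  *)
(* digit sequence of almost every point of R^2 normal to base q; pulling the  *)
(* coverings back by the Lipschitz map T^-m extends this to the basin.        *)
(* Normality says that the windows of the orbit are distributed according to  *)
(* the Bernoulli measure, which gives equidistribution by the closeness above *)
(* and the uniform continuity of the test function on the compact set R^2.    *)

Require Import Defs.
From mathcomp Require Import all_boot all_order all_algebra finmap.
From mathcomp Require Import generic_quotient ring_quotient ring lra zify.
From mathcomp Require Import all_classical all_reals all_analysis.
From mathcomp Require Import measurable_realfun.

Set Implicit Arguments.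
Unset Strict Implicit.
Unset Printing Implicit Defensive.
Import Order.TTheory GRing.Theory Num.Theory.
Import numFieldNormedType.Exports.

Local Open Scope classical_set_scope.
Local Open Scope ring_scope.

(** Along an orbit, [x1 = x1 ^+ q - b^-1 * (x2 - a * x0)] recovers each first coordinate from its
    neighbours and itself. Once the digit of [x1] is fixed, the right-hand side contracts by
    [c = 1/q] ([contraction_le]): the power map does because [x^q = x] and [q = 0] hold in the
    residue field ([absv_expr_card]), the linear part because [|b^-1| = 1/q] and [|a| < 1]. Two
    orbit segments with equal digits are therefore close away from their ends, the error decaying
    from both sides ([orbits_close]).

    This one estimate has three uses. For two-sided itineraries it yields uniqueness and continuity
    of the coding, existence being a fixed point iteration ([encoded_exists], [omega_close]). For a
    long segment it puts the middle of an orbit near a value of [omega] ([iter_close_omega]). For a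
    segment with approximately known second coordinate it bounds the first ([coding_inj]), which
    turns the Haar measure of a set of digit words into a count of words ([bad_words_cover]).

    The count is an exponential moment bound ([count_walk_ge]). With Borel-Cantelli it shows that
    almost every point has unbiased digits ([null_walk_ge], [negligible_abnormal]), so that every
    word has the expected frequency ([normal_frequency]). Replacing a continuous function by one
    that depends on finitely many digits then identifies the time average with the Bernoulli
    integral ([normal_avg_cvg]). *)

Lemma expr_lt_exists (R : realType) (r e : R) : 0 <= r < 1 -> 0 < e ->
  exists n, r ^+ n < e.
Proof.
move=> /andP[r0 r1] e0; have := @cvg_expr R r; rewrite ger0_norm// => /(_ r1).
move=> /cvgr0Pnorm_lt /(_ _ e0) [n _ /(_ n (leqnn _))].
by rewrite ger0_norm ?exprn_ge0// => h; exists n.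
Qed.

(** * The residue field *)

Section finite_field.
Context (F : comNzRingType) (E : seq F).
Hypothesis uniqE : uniq E.
Hypothesis allE : forall z, z \in E.
Hypothesis invE : forall x : F, x != 0 -> exists y, x * y = 1.

(** Translation by 1 permutes [E], so the sum of all elements is unchanged by adding [size E] to
    it. *)
Lemma natr_size_enum : (size E)%:R = 0 :> F.
Proof.
have P : perm_eq [seq z + 1 | z <- E] E.
  apply: uniq_perm => //; first by rewrite map_inj_uniq//; exact: addIr.
  move=> z; rewrite allE; apply/mapP; exists (z - 1) => //.
  by rewrite subrK.
have := perm_big (op := +%R) (x := 0) (P := predT) (F := id) _ P.
rewrite /= big_map big_split/= => /(canRL (addKr _)).
by rewrite addNr big_const_seq iter_addr_0 count_predT.
Qed.

(** Fermat's argument: multiplication by a nonzero [x] permutes the nonzero elements, whose product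
    can be cancelled. *)
Lemma expr_size_enum (x : F) : x ^+ size E = x.
Proof.
have cancel_unit (u v w : F) : u != 0 -> u * v = u * w -> v = w.
  move=> /invE[u' uu'] /(congr1 ( *%R u')).
  by rewrite !mulrA (mulrC u') uu' !mul1r.
have [->|x0] := eqVneq x 0.
  by rewrite expr0n; case: E (allE 0).
have P : perm_eq [seq x * z | z <- E] E.
  apply: uniq_perm => //.
    by rewrite map_inj_uniq// => u v; exact: cancel_unit.
  move=> z; rewrite allE; apply/mapP; have [y xy] := invE x0.
  by exists (y * z); rewrite // mulrA xy mul1r.
have prod0 (s : seq F) : \prod_(z <- s | z != 0) z != 0.
  elim: s => [|z s ih]; first by rewrite big_nil oner_neq0.
  rewrite big_cons; case: ifPn => // z0; apply/eqP => h.
  by move/eqP: ih; apply; apply: (@cancel_unit z) => //; rewrite mulr0.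
have := perm_big (op := *%R) (x := 1) (P := fun z => z != 0) (F := id) _ P.
rewrite /= big_map.
rewrite (eq_bigl (fun z => z != 0)); last first.
  move=> z; apply/idP/idP; apply: contraNN => /eqP.
    by move=> ->; rewrite mulr0.
  by rewrite -[RHS](mulr0 x) => /(cancel_unit _ _ _ x0) ->.
rewrite big_split/= big_const_seq iter_mulr_1 => xP.
have h : x ^+ count (fun z : F => z != 0) E = 1.
  by apply: (cancel_unit _ _ _ (prod0 E)); rewrite mulr1 mulrC.
have cE : count (fun z : F => z != 0) E = (size E).-1.
  have := count_predC (pred1 (0 : F)) E.
  by rewrite count_uniq_mem// allE => <-.
have s0 : (0 < size E)%N by case: E (allE 0).
by rewrite -(prednK s0) exprS -cE h mulr1.
Qed.

End finite_field.

(** * Ultrametric inequalities, digits and the power map *)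

Section absolute_value.
Context {R : realType} {K : nonArchLocalFieldType R}.
Implicit Types x y z : K.

Lemma absv0 : absv (0 : K) = 0. Proof. exact/absv_eq0. Qed.

Lemma absvN x : absv (- x) = absv x.
Proof. by rewrite -mulN1r absvM absvN1 mul1r. Qed.

Lemma absvBC x y : absv (x - y) = absv (y - x).
Proof. by rewrite -absvN opprB. Qed.

Lemma absvX x n : absv (x ^+ n) = absv x ^+ n.
Proof. by elim: n => [|n ih]; rewrite ?absv1// !exprS absvM ih. Qed.

Lemma absv_gt0 x : (0 < absv x) = (x != 0).
Proof.
rewrite lt_neqAle absv_ge0 andbT eq_sym; congr (~~ _).
by apply/eqP/eqP => /absv_eq0.
Qed.

Lemma absvV x : absv x^-1 = (absv x)^-1.
Proof.
have [->|x0] := eqVneq x 0; first by rewrite invr0 absv0 invr0.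
have ax0 : absv x != 0 by rewrite gt_eqF// absv_gt0.
by apply: (mulfI ax0); rewrite -absvM divff// divff// absv1.
Qed.

Lemma absvD_le x y e : absv x <= e -> absv y <= e -> absv (x + y) <= e.
Proof. by move=> xe ye; rewrite (le_trans (absvD _ _))// ge_max xe. Qed.

Lemma absvB_le x y e : absv x <= e -> absv y <= e -> absv (x - y) <= e.
Proof. by move=> xe ye; rewrite absvD_le// absvN. Qed.

Lemma absvB_trans y x z e :
  absv (x - y) <= e -> absv (y - z) <= e -> absv (x - z) <= e.
Proof. by move=> xe ye; rewrite -(subrKA y) absvD_le// -absvN opprB. Qed.

Lemma absv_sum_le (I : Type) (s : seq I) (f : I -> K) e : 0 <= e ->
  (forall i, absv (f i) <= e) -> absv (\sum_(i <- s) f i) <= e.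
Proof.
move=> e0 fe; elim: s => [|i s ih]; first by rewrite big_nil absv0.
by rewrite big_cons absvD_le.
Qed.

End absolute_value.

Section integers.
Context {R : realType} {K : nonArchLocalFieldType R}.
Implicit Types x : integers K.

Lemma integers_valX x n : integers_val (x ^+ n) = (x : K) ^+ n.
Proof. by elim: n => [|n ih] //; rewrite !exprS -ih. Qed.

Lemma integers_valMn n : integers_val (n%:R : integers K) = (n%:R : K).
Proof. by elim: n => [|n ih] //; rewrite !mulrS -ih. Qed.

End integers.

Section residue.
Context {R : realType} {K : nonArchLocalFieldType R} (pi : uniformizer K).
Local Notation q := (residue_card pi).
Local Notation F := (residue_field pi).
Hypothesis absv_pi : absv (pi : K) = q%:R^-1.

Definition residues : seq F := enum_fset (fset_set [set: F]).

Lemma unif_neq0K : (pi : K) != 0.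
Proof.
apply/eqP => h; apply: (@unif_neq0 _ _ pi); apply: val_inj.
by rewrite /= h.
Qed.

Lemma residue_card_gt1 : (1 < q)%N.
Proof.
have /= := unif_lt1 pi; have := unif_neq0K; rewrite -absv_gt0 absv_pi.
rewrite invr_gt0 ltr0n => q0.
by rewrite invf_lt1 ?ltr0n// ltr1n.
Qed.

(** Read off from the normalization of [|pi|]: for an infinite set [fset_set] is empty, which would
    give [q = 0]. *)
Lemma finite_residue : finite_set [set: F].
Proof.
apply: contrapT => h; have := residue_card_gt1.
by rewrite /residue_card /fset_set; case: pselect => //= _; rewrite cardfs0.
Qed.

Lemma mem_residues z : z \in residues.
Proof. by rewrite in_fset_set ?inE//; exact: finite_residue. Qed.

Lemma uniq_residues : uniq residues. Proof. exact: fset_uniq. Qed.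

Lemma size_residues : size residues = q.
Proof. by rewrite /residue_card cardfE cardE. Qed.

Lemma reduction_eq (x y : integers K) :
  reduction pi x = reduction pi y <-> absv ((x : K) - (y : K)) <= q%:R^-1.
Proof.
have -> : (reduction pi x = reduction pi y) <-> x - y \in unif_ideal pi.
  by rewrite Quotient.idealrBE; split => [/eqP|/eqP].
split=> [/unif_idealP[z /(congr1 (@integers_val _ _))/= ->]|xq].
  rewrite absvM absv_pi ler_piMr ?invr_ge0//.
  by have := integersP z; rewrite inE.
apply/unif_idealP.
have h : ((x : K) - (y : K)) / (pi : K) \in @integers_pred _ K.
  rewrite inE absvM absvV absv_pi invrK.
  have q0 : 0 < q%:R :> R by rewrite ltr0n (ltn_trans _ residue_card_gt1).
  by rewrite -ler_pdivlMr// mul1r.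
exists (Integers h); apply: val_inj; rewrite /= mulrC divfK//.
exact: unif_neq0K.
Qed.

Lemma reduction_monoid_morphism : monoid_morphism (reduction pi).
Proof. by split=> [|x y]; rewrite /reduction ?rmorph1 ?rmorphM. Qed.

Lemma reduction_surj (z : F) : exists x, reduction pi x = z.
Proof. by exists (repr z); rewrite /reduction reprK. Qed.

Definition to_integer (x : K) : integers K := insubd 0 x.

Lemma to_integerK x : absv x <= 1 -> to_integer x = x :> K.
Proof. by move=> x1; rewrite /to_integer insubdK// inE. Qed.

(** Total on [K]; outside the ring of integers it returns the digit of 0, so statements about [dig]
    assume [absv x <= 1]. *)
Definition dig (x : K) : F := reduction pi (to_integer x).

Lemma dig_eq x y : absv x <= 1 -> absv y <= 1 ->
  dig x = dig y <-> absv (x - y) <= q%:R^-1.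
Proof.
by move=> x1 y1; rewrite (reduction_eq (to_integer x)) !to_integerK.
Qed.

Lemma residue_discP s x : residue_disc s x <-> absv x <= 1 /\ dig x = s.
Proof.
split=> [[r [<- <-]]|[x1 <-]]; last first.
  by exists (to_integer x); rewrite to_integerK.
have r1 : absv (r : K) <= 1 by have := integersP r; rewrite inE.
split => //; apply/(reduction_eq (to_integer r) r).
by rewrite to_integerK// subrr absv0 invr_ge0.
Qed.

Definition digit_rep (z : F) : K := xget 0 [set x | absv x <= 1 /\ dig x = z].

Lemma digit_repP z : absv (digit_rep z) <= 1 /\ dig (digit_rep z) = z.
Proof.
rewrite /digit_rep; case: xgetP => [x -> //|h].
have [r rz] := reduction_surj z.
have /residue_discP : residue_disc z (r : K) by exists r.
by move=> /h.
Qed.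

(** A lift of a nonzero residue has absolute value 1, since by [unif_max] anything smaller is at
    most [|pi|] and reduces to 0; its inverse is thus integral. *)
Lemma residue_inv (z : F) : z != 0 -> exists y, z * y = 1.
Proof.
have [r <-] := reduction_surj z => r0.
have q0 : (0 : R) < q%:R by rewrite ltr0n (ltn_trans _ residue_card_gt1).
have ar : absv (r : K) = 1.
  apply/eqP; rewrite eq_le; apply/andP; split.
    by have := integersP r; rewrite inE.
  rewrite leNgt; apply: contra_neqN r0 => r1.
  have -> : (0 : F) = reduction pi 0 by rewrite /reduction rmorph0.
  apply/reduction_eq; rewrite /= subr0 -absv_pi.
  exact: unif_max.
have h : (r : K)^-1 \in @integers_pred _ K by rewrite inE absvV ar invr1.
exists (reduction pi (Integers h)).
rewrite -(reduction_monoid_morphism.2) -(reduction_monoid_morphism.1).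
congr reduction; apply: val_inj => /=; rewrite divff//.
by rewrite -absv_gt0 ar.
Qed.

Lemma absv_frobenius (x : K) : absv x <= 1 -> absv (x ^+ q - x) <= q%:R^-1.
Proof.
move=> x1; have := expr_size_enum uniq_residues mem_residues residue_inv (dig x).
have -> : dig x ^+ size residues = reduction pi (to_integer x ^+ q).
  by rewrite size_residues /dig /reduction rmorphXn.
by move/reduction_eq; rewrite integers_valX to_integerK.
Qed.

Lemma absv_card : absv (q%:R : K) <= q%:R^-1.
Proof.
have := natr_size_enum uniq_residues mem_residues; rewrite size_residues.
have -> : (q%:R : F) = reduction pi q%:R by rewrite /reduction rmorph_nat.
have -> : (0 : F) = reduction pi 0 by rewrite /reduction rmorph0.
by move/reduction_eq; rewrite integers_valMn subr0.
Qed.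

(** Factor out [x - y]: since [y] is congruent to [x], the cofactor is congruent to [q * x^(q-1)]
    modulo [pi], hence to 0. *)
Lemma absv_expr_card (x y : K) : absv x <= 1 -> absv y <= 1 ->
  absv (x - y) <= q%:R^-1 -> absv (x ^+ q - y ^+ q) <= q%:R^-1 * absv (x - y).
Proof.
move=> x1 y1 xy; rewrite subrXX absvM mulrC ler_wpM2r ?absv_ge0//.
have q0 : 0 <= (q%:R : R)^-1 by rewrite invr_ge0.
have absX1 (z : K) n : absv z <= 1 -> absv (z ^+ n) <= 1.
  by move=> z1; rewrite absvX exprn_ile1 ?absv_ge0.
have -> : \sum_(i < q) x ^+ (q.-1 - i) * y ^+ i =
    \sum_(i < q) x ^+ (q.-1 - i) * (y ^+ i - x ^+ i) + q%:R * x ^+ q.-1.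
  have -> : q%:R * x ^+ q.-1 = \sum_(i < q) x ^+ q.-1.
    by rewrite sumr_const card_ord mulr_natl.
  rewrite -big_split/=; apply: eq_bigr => i _.
  rewrite mulrBr -exprD subnK ?subrK// -ltnS prednK//.
  exact: (leq_ltn_trans _ (ltn_ord i)).
apply: absvD_le; last first.
  by rewrite absvM (le_trans _ absv_card)// ler_piMr ?absv_ge0 ?absX1.
apply: absv_sum_le => // i; rewrite absvM.
apply: le_trans (_ : absv (y ^+ i - x ^+ i) <= _).
  by rewrite ler_piMl ?absv_ge0 ?absX1.
rewrite subrXX absvM absvBC (le_trans _ xy)// ler_piMr ?absv_ge0//.
by apply: absv_sum_le => // j; rewrite absvM mulr_ile1 ?absv_ge0 ?absX1.
Qed.

End residue.

(** * Orbits and itineraries *)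

(* Applied to the distances between two solutions of the recurrence: the      *)
(* first term bounds the influence of the future, the second that of the past. *)
Lemma damped_bound (R : realType) (c : R) (D : nat -> R) (N : nat) :
  0 <= c <= 1 -> (forall i, (i <= N.+1)%N -> 0 <= D i <= 1) ->
  (forall i, (i < N)%N -> D i.+1 <= c * Num.max (D i) (D i.+2)) ->
  forall i, (i <= N.+1)%N ->
    D i <= Num.max (c ^+ (N.+1 - i)) (c ^+ i * D 0).
Proof.
move=> /andP[c0 c1] D01 Dstep.
have cle m n : (n <= m)%N -> c ^+ m <= c ^+ n.
  by move=> nm; apply: ler_wiXn2l.
(* Each use of the recursion improves the trivial bound by a factor [c], recorded as [c ^+ j]; at
   [j = N + 1] this term is absorbed by [c ^+ (N.+1 - i)]. *)
suff P j i : (i <= N.+1)%N ->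
    D i <= Num.max (c ^+ j) (Num.max (c ^+ (N.+1 - i)) (c ^+ i * D 0)).
  move=> i iN; apply: le_trans (P N.+1 i iN) _.
  by rewrite ge_max lexx andbT le_max cle ?leq_subr.
elim: j i => [|j ih] i iN.
  by rewrite le_max expr0; case/andP: (D01 _ iN) => _ ->.
case: i iN => [_|k kN]; first by rewrite expr0 mul1r !le_max lexx !orbT.
have [kN'|] := ltnP k N; last first.
  move=> Nk; have -> : k = N by lia.
  by rewrite subnn expr0 !le_max; case/andP: (D01 N.+1 (leqnn _)) => _ ->; rewrite orbT.
apply: (le_trans (Dstep _ kN')).
have D0 : 0 <= D 0 by case/andP: (D01 0 isT).
rewrite maxr_pMr// ge_max; apply/andP; split.
  apply: (le_trans (ler_wpM2l c0 (ih k _))); first by lia.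
  rewrite !maxr_pMr// mulrA -!exprS !ge_max !le_max !lexx !orbT/= andbT.
  by rewrite (cle _ (N.+1 - k.+1)%N) ?orbT//; lia.
apply: (le_trans (ler_wpM2l c0 (ih k.+2 _))); first by lia.
rewrite !maxr_pMr// mulrA -!exprS !ge_max !le_max lexx/=.
rewrite (cle _ (N.+1 - k.+1)%N) ?orbT//=; last by lia.
by rewrite ler_wpM2r ?orbT// cle//; lia.
Qed.

Lemma nbhs_absvP (R : realType) (K : nonArchLocalFieldType R) (x : K)
    (A : set K) :
  nbhs x A <-> exists2 e : R, 0 < e & forall y, absv (x - y) < e -> A y.
Proof.
split=> [/nbhsP[B]|[e e0 eA]].
  rewrite absv_entourage => -[e /= e0 eB] BA; exists e => // y xy.
  by apply/BA/xsectionP/eB.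
apply/nbhsP; rewrite absv_entourage.
exists [set xy | absv (xy.1 - xy.2) < e]; first by exists e.
by move=> y /xsectionP; exact: eA.
Qed.

Lemma eq_of_absv_le_expr (R : realType) (K : nonArchLocalFieldType R) (c : R)
    (x y : K) : 0 < c < 1 -> (forall m, absv (x - y) <= c ^+ m) -> x = y.
Proof.
move=> /andP[c0 c1] le; apply/eqP; rewrite -subr_eq0; apply/eqP/absv_eq0.
apply/eqP; rewrite eq_le absv_ge0 andbT leNgt; apply/negP => x0.
have c01 : 0 <= c < 1 by rewrite (ltW c0).
by have [m] := expr_lt_exists c01 x0; rewrite ltNge le.
Qed.

Lemma absv_cauchy_cvg (R : realType) (K : nonArchLocalFieldType R) (c : R)
    (u : nat -> K) : 0 < c < 1 ->
  (forall m n, (m <= n)%N -> absv (u n - u m) <= c ^+ m) ->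
  exists l, forall m, absv (u m - l) <= c ^+ m.
Proof.
move=> /andP[c0 c1] uc.
have c01 : 0 <= c < 1 by rewrite (ltW c0).
have [l ul] : exists l : K, u n @[n --> \oo] --> l.
  apply: absv_complete => A; rewrite absv_entourage => -[e /= e0 eA].
  have [m cm] := expr_lt_exists c01 e0.
  exists ([set x | absv (x - u m) <= c ^+ m], [set x | absv (x - u m) <= c ^+ m]) => /=.
    by split; exists m => // n /= mn; exact: uc.
  move=> [x y] /= [xm ym]; apply: eA => /=.
  by rewrite (le_lt_trans _ cm)// (absvB_trans xm)// absvBC.
exists l => m; have cm : 0 < c ^+ m by rewrite exprn_gt0.
have /ul [n _ nP] : nbhs l [set y | absv (l - y) < c ^+ m].
  by apply/nbhs_absvP; exists (c ^+ m).
have /= lt := nP (maxn m n) (leq_maxr _ _).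
rewrite (absvB_trans (y := u (maxn m n)))//; first by rewrite absvBC uc ?leq_maxl.
by rewrite absvBC ltW.
Qed.

Section dynamics.
Context {R : realType} {K : nonArchLocalFieldType R} (pi : uniformizer K).
Variables a b : K.
Local Notation q := (residue_card pi).
Local Notation F := (residue_field pi).
Local Notation c := (q%:R^-1 : R).
Local Notation T := (T_map pi a b).
Hypothesis absv_pi : absv (pi : K) = c.
Hypothesis absv_a : 0 < absv a < 1.
Hypothesis absv_b : absv b = q%:R.

Lemma inv_card_gt0 : 0 < c.
Proof. by rewrite invr_gt0 ltr0n (ltn_trans _ (residue_card_gt1 absv_pi)). Qed.

Lemma inv_card_lt1 : c < 1.
Proof. by rewrite -absv_pi (unif_lt1 pi). Qed.

Lemma inv_card_lt01 : 0 < c < 1. Proof. by rewrite inv_card_gt0 inv_card_lt1. Qed.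

Lemma inv_card_ge01 : 0 <= c < 1.
Proof. by rewrite ltW ?inv_card_gt0 ?inv_card_lt1. Qed.

Lemma inv_card_le01 : 0 <= c <= 1. Proof. by rewrite !ltW ?inv_card_lt1 ?inv_card_gt0. Qed.

Lemma b_neq0 : b != 0.
Proof. by rewrite -absv_gt0 absv_b -invr_gt0 inv_card_gt0. Qed.

Lemma a_neq0 : a != 0.
Proof. by rewrite -absv_gt0; case/andP: absv_a. Qed.

Lemma absv_bV : absv b^-1 = c. Proof. by rewrite absvV absv_b. Qed.

(** Both differences gain a factor [1/q]: the powers by [absv_expr_card], the linear terms through
    [|b^-1|]. The same map serves to compare orbits and to construct them. *)
Lemma contraction_le (x0 x1 x2 y0 y1 y2 : K) (e : R) :
  absv x1 <= 1 -> absv y1 <= 1 -> dig pi x1 = dig pi y1 ->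
  absv (x0 - y0) <= e -> absv (x1 - y1) <= e -> absv (x2 - y2) <= e ->
  absv ((x1 ^+ q - b^-1 * (x2 - a * x0)) - (y1 ^+ q - b^-1 * (y2 - a * y0)))
    <= c * e.
Proof.
move=> x1' y1' /(dig_eq absv_pi x1' y1') d01 e0 e1 e2.
have e_ge0 : 0 <= e := le_trans (absv_ge0 _) e0.
have -> : (x1 ^+ q - b^-1 * (x2 - a * x0)) - (y1 ^+ q - b^-1 * (y2 - a * y0)) =
  (x1 ^+ q - y1 ^+ q) - b^-1 * ((x2 - y2) - a * (x0 - y0)).
  by move: (x1 ^+ q) (y1 ^+ q) => X Y; ring.
have [c0 c1] := andP inv_card_le01.
apply: absvB_le.
  by rewrite (le_trans (absv_expr_card absv_pi x1' y1' d01))// ler_wpM2l.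
rewrite absvM absv_bV ler_wpM2l// absvB_le// absvM (le_trans _ e0)//.
by rewrite ler_piMl ?absv_ge0//; case/andP: absv_a => _ /ltW.
Qed.

(** Equivalent to [T (x1, x0) = (x2, x1)]. *)
Definition recurrent (x0 x1 x2 : K) := x2 = a * x0 + b * (x1 ^+ q - x1).

Lemma recurrentP x0 x1 x2 :
  recurrent x0 x1 x2 <-> x1 = x1 ^+ q - b^-1 * (x2 - a * x0).
Proof.
have b0 := b_neq0.
split=> [->|h]; first by move: (x1 ^+ q) => X; field.
rewrite /recurrent; move: (x1 ^+ q) h => X h.
have <- : b^-1 * (x2 - a * x0) = X - x1 by rewrite h; ring.
by field.
Qed.

Lemma recurrent_close (x0 x1 x2 y0 y1 y2 : K) :
  recurrent x0 x1 x2 -> recurrent y0 y1 y2 ->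
  absv x1 <= 1 -> absv y1 <= 1 -> dig pi x1 = dig pi y1 ->
  absv (x1 - y1) <= c * Num.max (absv (x0 - y0)) (absv (x2 - y2)).
Proof.
move=> /recurrentP hx /recurrentP hy x11 y11 xy1.
set e := Num.max _ _.
have [le|lt] := leP (absv (x1 - y1)) e.
  rewrite {1}hx {1}hy; apply: contraction_le => //; rewrite /e le_max lexx ?orbT//.
(* If the middle distance exceeded both outer ones, the contraction applied with that distance as
   [e] would bound it by [c] times itself. *)
suff d0 : absv (x1 - y1) <= 0.
  by rewrite (le_trans d0)// mulr_ge0 ?(ltW inv_card_gt0)// le_max absv_ge0.
have : absv (x1 - y1) <= c * absv (x1 - y1).
  rewrite {1}hx {1}hy; apply: contraction_le => //; rewrite (le_trans _ (ltW lt))//.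
    by rewrite /e le_max lexx.
  by rewrite /e le_max lexx orbT.
have := inv_card_lt1; nra.
Qed.

Lemma orbits_close (N : nat) (u v : nat -> K) :
  (forall i, (i <= N.+1)%N -> absv (u i) <= 1 /\ absv (v i) <= 1) ->
  (forall i, (i < N)%N -> [/\ recurrent (u i) (u i.+1) (u i.+2),
    recurrent (v i) (v i.+1) (v i.+2) & dig pi (u i.+1) = dig pi (v i.+1)]) ->
  forall i, (i <= N.+1)%N ->
    absv (u i - v i) <=
      Num.max (c ^+ (N.+1 - i)) (c ^+ i * absv (u 0 - v 0)).
Proof.
move=> uv1 uvrec i iN.
apply: (@damped_bound R c (fun i => absv (u i - v i)) N) => //.
- exact: inv_card_le01.
- by move=> j jN; have [u1 v1] := uv1 _ jN; rewrite absv_ge0 absvB_le.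
- move=> j jN; have [ru rv d] := uvrec _ jN.
  have jN' : (j.+1 <= N.+1)%N by lia.
  by have [u1 v1] := uv1 _ jN'; exact: recurrent_close.
Qed.

Local Notation square := (@integral_square R K).

(** The expansion [|b| = q] is exactly compensated by [|x^q - x| <= 1/q] on the ring of integers. *)
Lemma T_map_square p : square p -> square (T p).
Proof.
move=> [p1 p2]; split=> //=; apply: absvD_le; rewrite absvM.
  by rewrite mulr_ile1 ?absv_ge0//; case/andP: absv_a => _ /ltW.
have q0 : 0 < q%:R :> R by rewrite -invr_gt0 inv_card_gt0.
by rewrite absv_b mulrC -ler_pdivlMr// mul1r; exact: absv_frobenius.
Qed.

Lemma iter_T_square n p : square p -> square (iter n T p).
Proof. by move=> p1; elim: n => //= n; exact: T_map_square. Qed.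

Lemma T_mapK : cancel T (T_inv pi a b).
Proof.
move=> [x y]; rewrite /T_inv /=; congr pair.
by rewrite addrK mulrA mulVf ?mul1r// a_neq0.
Qed.

Lemma T_invK : cancel (T_inv pi a b) T.
Proof.
move=> [x y]; rewrite /T_map /=; congr pair.
by rewrite mulrA mulfV ?mul1r ?subrK// a_neq0.
Qed.

Lemma T_powS (k : int) p : T_pow pi a b (k + 1) p = T (T_pow pi a b k p).
Proof.
case: k => [n|n]; first by rewrite -PoszD addn1.
case: n => [|n]; first by rewrite [LHS]/= T_invK.
have -> : Negz n.+1 + 1 = Negz n by lia.
by rewrite /T_pow iterS T_invK.
Qed.

(* x is the sequence of first coordinates of a full orbit with itinerary s;   *)
(* the orbit itself is k |-> (x k, x (k - 1)).                                *)
Definition encoded (s : bisequence pi) (x : int -> K) :=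
  forall k, [/\ recurrent (x (k - 1)) (x k) (x (k + 1)), absv (x k) <= 1 &
                dig pi (x k) = s k].

Lemma encoded_coded s x : encoded s x -> coded_by a b s (x 0, x (-1)).
Proof.
move=> ex.
have step k : T (x k, x (k - 1)) = (x (k + 1), x k).
  by rewrite /T_map /=; have [-> _ _] := ex k.
have powE k : T_pow pi a b k (x 0, x (-1)) = (x k, x (k - 1)).
  have E0 : T_pow pi a b 0 (x 0, x (-1)) = (x 0, x (0 - 1)) by rewrite sub0r.
  elim/int_rect: k => // n ih.
    by rewrite -addn1 PoszD T_powS ih step addrK.
  apply: (can_inj T_mapK); rewrite -T_powS step.
  by rewrite -addn1 PoszD opprD subrK ih.
have x1 k : absv (x k) <= 1 by case: (ex k).
split.
(* The point of the full orbit at time [-n] is the preimage in [R^2] required by the attractor. *)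
- move=> n _ /=; exists (x (- n%:Z), x (- n%:Z - 1)); first by split; exact: x1.
  elim: n => [|n ih]; first by rewrite oppr0 sub0r.
  by rewrite iterSr step -ih -addn1 PoszD opprD subrK.
- move=> k _; rewrite powE /=; split => //.
  by apply/residue_discP => //; case: (ex k).
- move=> k _; rewrite powE addrK /=; split => //.
  by apply/residue_discP => //; case: (ex k).
Qed.

Lemma coded_encoded s p : coded_by a b s p ->
  exists x, encoded s x /\ p = (x 0, x (-1)).
Proof.
move=> [_ pos neg]; pose x k := (T_pow pi a b k p).1; exists x.
have powE k : T_pow pi a b (k + 1) p = (x (k + 1), x k).
  by rewrite [LHS]surjective_pairing; congr pair; rewrite T_powS.
have powE' k : T_pow pi a b k p = (x k, x (k - 1)).
  by have := powE (k - 1); rewrite subrK.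
split; last first.
  by have /= := powE' 0; rewrite sub0r.
move=> k.
have [x1 dx] : absv (x k) <= 1 /\ dig pi (x k) = s k.
  have [k0|k0] := leP 0 k.
    by have [/(residue_discP absv_pi)] := pos k k0.
  have [] := neg k _; first by lia.
  by rewrite powE => _ /(residue_discP absv_pi).
split=> //; have := T_powS k p.
by rewrite powE powE' /T_map /= => -[->].
Qed.

Lemma close_encoded s x p M n : encoded s x -> square p ->
  (forall i, (i <= M.*2)%N ->
     dig pi (iter (n + i) T p).1 = s (i%:Z - M%:Z)) ->
  absv ((iter (n + M) T p).1 - x 0) <= c ^+ M /\
  absv ((iter (n + M) T p).2 - x (-1)) <= c ^+ M.
Proof.
move=> ex sp ds.
(* Starting from the second coordinate makes each iterate a pair of neighbours [(u j.+1, u j)]. The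
   digits are known at indices 1 to [2M + 1], and the iterate at time [n + M] occupies the central
   indices [M + 1] and [M]. *)
pose u i := if i is j.+1 then (iter (n + j) T p).1 else (iter n T p).2.
pose v (i : nat) := x (i%:Z - M%:Z - 1).
have uE j : iter (n + j) T p = (u j.+1, u j).
  case: j => [|j]; first by rewrite /u addn0 -surjective_pairing.
  by rewrite [LHS]surjective_pairing; congr pair; rewrite addnS.
have sq j : square (iter j T p) by exact: iter_T_square.
have uv1 i : absv (u i) <= 1 /\ absv (v i) <= 1.
  split; last by case: (ex (i%:Z - M%:Z - 1)).
  by have := sq (n + i)%N; rewrite uE => -[].
have rec i : (i < (M.*2).+1)%N -> [/\ recurrent (u i) (u i.+1) (u i.+2),
    recurrent (v i) (v i.+1) (v i.+2) & dig pi (u i.+1) = dig pi (v i.+1)].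
  move=> iM.
  have vE : v i.+1 = x (i%:Z - M%:Z) by rewrite /v; congr x; lia.
  have [rv _ dv] := ex (i%:Z - M%:Z).
  split; last by rewrite vE dv -ds.
    by have := uE i.+1; rewrite addnS /= uE /T_map /= => -[].
  by rewrite vE /v; move: rv; congr recurrent; congr x; lia.
have close := orbits_close (fun i _ => uv1 i) rec.
have c_le m m' : (m <= m')%N -> c ^+ m' <= c ^+ m.
  have [c0 c1] := andP inv_card_le01; exact: ler_wiXn2l.
have u0 : absv (u 0 - v 0) <= 1 by have [? ?] := uv1 0; exact: absvB_le.
rewrite uE /=; split.
  have -> : x 0 = v M.+1 by rewrite /v; congr x; lia.
  apply: (le_trans (close M.+1 _)); first by lia.
  rewrite ge_max c_le//=; last by lia.
  rewrite (le_trans (_ : _ <= c ^+ M.+1)) ?c_le//.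
  by rewrite ler_piMr// exprn_ge0// ltW// inv_card_gt0.
have -> : x (-1) = v M by rewrite /v; congr x; lia.
apply: (le_trans (close M _)); first by lia.
rewrite ge_max c_le//=; last by lia.
by rewrite ler_piMr// exprn_ge0// ltW// inv_card_gt0.
Qed.

(** Fixed point iteration on two-sided sequences, started at digit representatives. Each step moves
    every term by at most [1/q], so the digits stay equal to [s]; hence successive iterates get
    closer by the factor [c], uniformly in the index, and converge termwise. *)
Lemma encoded_exists s : exists x, encoded s x.
Proof.
pose step (x : int -> K) k := x k ^+ q - b^-1 * (x (k + 1) - a * x (k - 1)).
pose y m := iter m step (fun k => digit_rep (s k)).
have [c0 c1] := andP inv_card_lt01.
have step_close x k : (forall k, absv (x k) <= 1) ->
    absv (step x k - x k) <= c.
  move=> x1; rewrite /step addrAC absvB_le//; first exact: absv_frobenius.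
  rewrite absvM absv_bV ler_piMr ?(ltW c0)// absvB_le// absvM mulr_ile1 ?absv_ge0//.
  by case/andP: absv_a => _ /ltW.
have absv_close (z w : K) : absv z <= 1 -> absv (w - z) <= c -> absv w <= 1.
  by move=> z1 zw; rewrite -(subrK z w) absvD_le// (le_trans zw) ?ltW.
have y_ok m k : absv (y m k) <= 1 /\ dig pi (y m k) = s k.
  elim: m k => [|m ih] k; first exact: digit_repP.
  have h := step_close (y m) k (fun k => (ih k).1).
  have h1 := absv_close _ _ (ih k).1 h.
  split=> //; rewrite -(ih k).2; apply/(dig_eq absv_pi) => //; exact: (ih k).1.
have yS m k : absv (y m.+1 k - y m k) <= c ^+ m.+1.
  elim: m k => [|m ih] k.
    by apply: step_close => k'; have [] := y_ok 0 k'.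
  rewrite exprS; apply: contraction_le; rewrite ?ih//.
  - by have [] := y_ok m.+1 k.
  - by have [] := y_ok m k.
  - by rewrite (y_ok m.+1 k).2 (y_ok m k).2.
have y_cauchy k m n : (m <= n)%N -> absv (y n k - y m k) <= c ^+ m.
  elim: n => [|n ih]; first by rewrite leqn0 => /eqP ->; rewrite subrr absv0.
  rewrite leq_eqVlt => /predU1P[->|]; first by rewrite subrr absv0 exprn_ge0 ?ltW.
  rewrite ltnS => mn; apply: (absvB_trans (y := y n k)); last exact: ih.
  apply: (le_trans (yS n k)); apply: ler_wiXn2l; rewrite ?ltW//.
  exact: leq_trans mn _.
have /choice[x xP] : forall k, exists l, forall m, absv (y m k - l) <= c ^+ m.
  by move=> k; exact: absv_cauchy_cvg inv_card_lt01 (y_cauchy k).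
have x1 k : absv (x k) <= 1.
  by apply: (absv_close (y 1 k)); [case: (y_ok 1 k)|rewrite absvBC (xP k 1)].
have dx k : dig pi (x k) = s k.
  have [y1 <-] := y_ok 1 k; apply/(dig_eq absv_pi) => //.
  by rewrite absvBC (xP k 1).
exists x => k; split=> //; apply/recurrentP.
(* The limit is a fixed point: both [x k] and its image under the step are within [c ^+ m] of
   [y m.+1 k]. *)
apply: (eq_of_absv_le_expr inv_card_lt01) => m.
apply: (absvB_trans (y := y m.+1 k)).
  rewrite absvBC (le_trans (xP k m.+1))//.
  by rewrite exprS ler_piMl ?exprn_ge0 ?ltW.
apply: (le_trans (_ : _ <= c * c ^+ m)).
  apply: contraction_le => //.
  - by have [] := y_ok m k.
  - by rewrite dx (y_ok m k).2.
by rewrite ler_piMl ?exprn_ge0 ?ltW.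
Qed.

End dynamics.

(** * The coding map and Lipschitz bounds for the inverse map *)

Section omega.
Context {R : realType} {K : nonArchLocalFieldType R} (pi : uniformizer K).
Variables a b : K.
Local Notation q := (residue_card pi).
Local Notation F := (residue_field pi).
Local Notation c := (q%:R^-1 : R).
Local Notation T := (T_map pi a b).
Local Notation square := (@integral_square R K).
Hypothesis absv_pi : absv (pi : K) = c.
Hypothesis absv_a : 0 < absv a < 1.
Hypothesis absv_b : absv b = q%:R.

Definition plane_close (e : R) (p p' : plane K) :=
  absv (p.1 - p'.1) <= e /\ absv (p.2 - p'.2) <= e.

Lemma plane_closeC e p p' : plane_close e p p' -> plane_close e p' p.
Proof. by move=> [h1 h2]; split; rewrite absvBC. Qed.

Lemma plane_close_trans e p p' p'' :
  plane_close e p p' -> plane_close e p' p'' -> plane_close e p p''.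
Proof.
by move=> [h1 h2] [k1 k2]; split; [exact: absvB_trans k1|exact: absvB_trans k2].
Qed.

Lemma encoded_iter (s : bisequence pi) x k i : encoded a b s x ->
  iter i T (x k, x (k - 1)) = (x (k + i%:Z), x (k + i%:Z - 1)).
Proof.
move=> ex; elim: i => [|i ih]; first by rewrite addr0.
rewrite iterS ih /T_map /=; congr pair; last by congr x; lia.
have [h _ _] := ex (k + i%:Z).
by rewrite -h; congr x; lia.
Qed.

Lemma encoded_square (s : bisequence pi) x k k' : encoded a b s x ->
  square (x k, x k').
Proof. by move=> ex; split => /=; [case: (ex k)|case: (ex k')]. Qed.

(** The orbit of [x], started at time [-M], is an orbit in [R^2] whose digits agree with [s'] on the
    whole window, so [close_encoded] applies at its centre. *)
Lemma encoded_close (s s' : bisequence pi) x x' M :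
  encoded a b s x -> encoded a b s' x' ->
  (forall k : int, (absz k <= M)%N -> s k = s' k) ->
  plane_close (c ^+ M) (x 0, x (-1)) (x' 0, x' (-1)).
Proof.
move=> ex ex' ss'.
have := @close_encoded _ _ _ _ _ absv_pi absv_a absv_b s' x'
  (x (- M%:Z), x (- M%:Z - 1)) M 0 ex' (encoded_square _ _ ex).
rewrite add0n (encoded_iter _ _ ex) addNr sub0r; apply => i iM.
rewrite add0n (encoded_iter _ _ ex) /= -ss'; last by lia.
by rewrite addrC; case: (ex (i%:Z - M%:Z)).
Qed.

Lemma encoded_uniq (s : bisequence pi) x x' :
  encoded a b s x -> encoded a b s x' -> (x 0, x (-1)) = (x' 0, x' (-1)).
Proof.
move=> ex ex'; have h M := encoded_close (M := M) ex ex' (fun _ _ => erefl).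
by congr pair; apply: (eq_of_absv_le_expr (inv_card_lt01 absv_pi)) => m; case: (h m).
Qed.

(** The default value of [xget] is never taken, because a coded point exists. *)
Lemma omegaP (s : bisequence pi) :
  exists x, encoded a b s x /\ omega a b s = (x 0, x (-1)).
Proof.
apply: (coded_encoded absv_pi absv_a); rewrite /omega.
have [x ex] := encoded_exists absv_pi absv_a absv_b s.
case: xgetP => [p -> //|h]; exfalso; apply: (h (x 0, x (-1))).
exact: (encoded_coded absv_pi absv_a).
Qed.

Lemma omega_square s : square (omega (pi := pi) a b s).
Proof. by have [x [ex ->]] := omegaP s; exact: encoded_square ex. Qed.

Lemma omega_close (s s' : bisequence pi) M :
  (forall k : int, (absz k <= M)%N -> s k = s' k) ->
  plane_close (c ^+ M) (omega a b s) (omega a b s').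
Proof.
have [x [ex ->]] := omegaP s; have [x' [ex' ->]] := omegaP s'.
exact: encoded_close.
Qed.

Lemma iter_close_omega (s : bisequence pi) p M n : square p ->
  (forall i, (i <= M.*2)%N ->
     dig pi (iter (n + i) T p).1 = s (i%:Z - M%:Z)) ->
  plane_close (c ^+ M) (iter (n + M) T p) (omega a b s).
Proof.
move=> sp ds; have [x [ex ->]] := omegaP s.
exact: (close_encoded absv_pi absv_a absv_b ex sp ds).
Qed.

Lemma omega_shift (s : bisequence pi) :
  omega a b (fun k => s (k + 1) : residue_field pi) = T (omega a b s).
Proof.
have [x [ex ->]] := omegaP s; have [x' [ex' ->]] := omegaP (fun k => s (k + 1)).
have ex1 : encoded a b (fun k => s (k + 1)) (fun k => x (k + 1)).
  by move=> k; have := ex (k + 1); rewrite subrK addrK.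
rewrite -[T _]/(iter 1 T _) -[x (-1)]/(x (0 - 1)) (encoded_iter _ _ ex).
exact: (encoded_uniq ex' ex1).
Qed.

Lemma absvD_sum (x y : K) (d e : R) :
  absv x <= d -> absv y <= e -> absv (x + y) <= d + e.
Proof.
move=> xd ye; have d0 := le_trans (absv_ge0 _) xd.
have e0 := le_trans (absv_ge0 _) ye.
by apply: absvD_le; [rewrite (le_trans xd)// lerDl|rewrite (le_trans ye)// lerDr].
Qed.

(** The iterates of [T_inv] are polynomial maps. A single constant bounds both the size of the image
    of [R^2] and the Lipschitz constant, since the next Lipschitz constant depends on that size
    through [y^q]; [1 <= C] allows exponents to be raised freely. *)
Lemma T_inv_lipschitz m : exists2 C : R, 1 <= C &
  (forall p, square p -> plane_close C (iter m (T_inv pi a b) p) 0) /\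
  (forall e p p', square p -> square p' -> plane_close e p p' ->
     plane_close (C * e) (iter m (T_inv pi a b) p) (iter m (T_inv pi a b) p')).
Proof.
elim: m => [|m [C C1 [bd lip]]].
  exists 1 => //; split=> [p [p1 p2]|e p p' _ _]; last by rewrite mul1r.
  by split; rewrite /= subr0.
pose A := absv a^-1.
have A0 : 0 <= A by exact: absv_ge0.
have C0 : 0 <= C by exact: le_trans C1.
have Cq0 : 0 <= C ^+ q by exact: exprn_ge0.
have q0 : 0 <= q%:R :> R by [].
exists (C + A * (C + q%:R * (C ^+ q * C + C))).
  by rewrite (le_trans C1)// lerDl mulr_ge0// addr_ge0// mulr_ge0// addr_ge0// mulr_ge0.
split=> [p sp|e p p' sp sp' pp'].
  have [] := bd p sp; set u := iter m _ p => u1 u2; rewrite iterS -/u.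
  rewrite subr0 in u1; rewrite subr0 in u2.
  split; rewrite /= subr0.
    by rewrite (le_trans u2)// lerDl mulr_ge0// addr_ge0// mulr_ge0// addr_ge0// mulr_ge0.
  rewrite (le_trans _ (_ : A * (C + q%:R * (C ^+ q * C + C)) <= _))//; last first.
    by rewrite lerDr.
  rewrite absvM -/A ler_wpM2l//; apply: absvD_sum => //; rewrite absvN absvM absv_b.
  rewrite ler_wpM2l//; apply: absvD_sum; last by rewrite absvN.
  rewrite absvX (le_trans (_ : _ <= C ^+ q)) ?ler_peMr//.
  by apply: lerXn2r; rewrite ?nnegrE ?absv_ge0.
have [] := lip e p p' sp sp' pp'.
have [] := bd p sp; have [] := bd p' sp'.
set u := iter m _ p; set u' := iter m _ p'; rewrite !iterS -/u -/u' !subr0.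
move=> u'1 u'2 u1 u2 uu1 uu2.
have e0 : 0 <= e by case: pp' => h _; exact: le_trans (absv_ge0 _) h.
split => /=.
  rewrite (le_trans uu2)// ler_wpM2r// lerDl.
  by rewrite mulr_ge0// addr_ge0// mulr_ge0// addr_ge0// mulr_ge0.
rewrite (le_trans _ (_ : A * (C + q%:R * (C ^+ q * C + C)) * e <= _))//; last first.
  by rewrite ler_wpM2r// lerDr.
rewrite -mulrBr absvM -/A -mulrA ler_wpM2l//.
have -> : u.1 - b * (u.2 ^+ q - u.2) - (u'.1 - b * (u'.2 ^+ q - u'.2)) =
   (u.1 - u'.1) - b * ((u.2 ^+ q - u'.2 ^+ q) - (u.2 - u'.2)).
  by move: (u.2 ^+ q) (u'.2 ^+ q) => X Y; ring.
rewrite mulrDl; apply: absvD_sum => //; rewrite absvN absvM absv_b -mulrA.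
rewrite ler_wpM2l// mulrDl; apply: absvD_sum; last by rewrite absvN.
rewrite subrXX absvM mulrC -mulrA; apply: ler_pM; rewrite ?absv_ge0//.
apply: absv_sum_le => // i; rewrite absvM !absvX.
have -> : C ^+ q = C ^+ (q - i) * C ^+ i by rewrite -exprD subnK// ltnW.
have pow (z : K) n n' : absv z <= C -> (n <= n')%N -> absv z ^+ n <= C ^+ n'.
  move=> zC nn'; rewrite (le_trans (_ : _ <= C ^+ n))//; last exact: ler_weXn2l.
  by apply: lerXn2r; rewrite ?nnegrE ?absv_ge0.
apply: ler_pM; rewrite ?exprn_ge0 ?absv_ge0 ?pow//.
by rewrite leq_sub2r// leq_pred.
Qed.

End omega.

(** * Large deviations for digit frequencies *)

Section words.
Context (F : eqType) (E : seq F).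
Hypothesis uniqE : uniq E.
Hypothesis allE : forall z, z \in E.

(* Words are listed with the most recent digit first. *)
Fixpoint words n : seq (seq F) :=
  if n is m.+1 then [seq d :: t | t <- words m, d <- E] else [:: [::]].

Lemma mem_words n w : (w \in words n) = (size w == n).
Proof.
elim: n w => [|n ih] w /=; first by rewrite inE; case: w.
apply/allpairsP/idP => [[[t d] /= [tn _ ->]]|].
  by rewrite /= eqSS -ih.
case: w => //= d t; rewrite eqSS -ih => tn.
by exists (t, d).
Qed.

Lemma uniq_words n : uniq (words n).
Proof.
elim: n => //= n ih; apply: allpairs_uniq => //.
by move=> [t d] [t' d'] _ _ /= [-> ->].
Qed.

Lemma size_words n : size (words n) = (size E ^ n)%N.
Proof. by elim: n => //= n ih; rewrite size_allpairs ih expnSr. Qed.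

Context {R : realType}.

Lemma sum_words_indic n (f : seq F -> R) w : size w = n ->
  \sum_(v <- words n) f v * (v == w)%:R = f w.
Proof.
move=> wn; rewrite (bigD1_seq w)/= ?uniq_words ?mem_words ?wn//.
rewrite eqxx mulr1 big1 ?addr0// => v /negbTE ->.
by rewrite mulr0.
Qed.

Variable g : seq F -> F -> R.
Hypothesis sum_g : forall t, \sum_(d <- E) g t d = 0.
Hypothesis g_le1 : forall t d, `|g t d| <= 1.

Fixpoint walk (w : seq F) : R := if w is d :: t then walk t + g t d else 0.

(** A product replaces the exponential of [th * walk w]: as the increments have mean zero, its
    average over the words of each length is exactly 1. *)
Fixpoint martingale (th : R) (w : seq F) : R :=
  if w is d :: t then martingale th t * (1 + th * g t d) else 1.

Lemma sum_martingale th n :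
  \sum_(w <- words n) martingale th w = (size E)%:R ^+ n.
Proof.
elim: n => [|n ih] /=; first by rewrite big_seq1.
rewrite big_allpairs_dep/= exprSr -ih mulr_suml; apply: eq_bigr => t _.
rewrite -mulr_sumr big_split/= -mulr_sumr sum_g mulr0 addr0.
by rewrite big_const_seq count_predT iter_addr_0.
Qed.

(** Pass to inverses: [(1 - x + 2x^2)(1 + x) = 1 + x^2 (1 + 2x) >= 1], and [1 - x + 2x^2] is at most
    the exponential of [-x + 2x^2]. *)
Lemma expR_le_1D (x : R) : - 2^-1 <= x -> expR (x - 2 * x ^+ 2) <= 1 + x.
Proof.
move=> x2; have x1 : 0 < 1 + x by lra.
rewrite -[x - _]opprK expRN -[leRHS]invrK lef_pV2 ?posrE ?invr_gt0 ?expR_gt0//.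
apply: le_trans (expR_ge1Dx _).
rewrite -[leLHS]mul1r ler_pdivrMr//.
have -> : (1 + - (x - 2 * x ^+ 2)) * (1 + x) = 1 + x ^+ 2 * (1 + 2 * x) by ring.
by rewrite lerDl mulr_ge0 ?sqr_ge0//; lra.
Qed.

Lemma martingale_ge th w : 0 <= th <= 2^-1 ->
  expR (th * walk w - 2 * th ^+ 2 * (size w)%:R) <= martingale th w.
Proof.
move=> /andP[th0 th2]; elim: w => [|d t ih] /=.
  by rewrite !mulr0 subrr expR0.
have -> : th * (walk t + g t d) - 2 * th ^+ 2 * (size t).+1%:R =
    (th * walk t - 2 * th ^+ 2 * (size t)%:R) + (th * g t d - 2 * th ^+ 2).
  by rewrite -natr1; ring.
rewrite expRD; apply: ler_pM; rewrite ?expR_ge0//.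
have := g_le1 t d; rewrite ler_norml => /andP[g1 g2].
apply: le_trans (expR_le_1D _); last by nra.
rewrite ler_expR lerB// ler_wpM2l//.
rewrite exprMn -[leRHS]mulr1 ler_wpM2l ?sqr_ge0//.
by nra.
Qed.

(** Markov's inequality for [martingale]. The choice [th = e / 4] maximizes [th * e - 2 * th^2],
    with value [e^2 / 8], and [e <= 2] keeps [th <= 1/2]. *)
Lemma count_walk_ge (e : R) n : 0 < e <= 2 ->
  (count (fun w => e * n%:R <= walk w) (words n))%:R <=
    (size E)%:R ^+ n * expR (- (e ^+ 2 / 8)) ^+ n.
Proof.
move=> /andP[e0 e2]; pose th := e / 4.
have th12 : 0 <= th <= 2^-1 by rewrite /th; apply/andP; split; lra.
set m := expR (- (e ^+ 2 / 8)) ^+ n.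
have m0 : 0 < m by rewrite exprn_gt0// expR_gt0.
rewrite -ler_pdivrMr// -(sum_martingale th) -sum1_count natr_sum.
rewrite big_mkcond [leRHS]big_seq mulr_suml [leLHS]big_seq.
apply: ler_sum => w; rewrite mem_words => /eqP wn.
apply: le_trans (martingale_ge _ th12).
case: ifPn => [we|_]; last by rewrite mul0r expR_ge0.
rewrite mul1r /m -expRM_natl -expRN ler_expR wn.
apply: le_trans (_ : th * (e * n%:R) - 2 * th ^+ 2 * n%:R <= _).
  by rewrite /th -[_ *+ n]mulr_natr le_eqVlt; apply/orP; left; apply/eqP; field.
by rewrite lerB// ler_wpM2l//; case/andP: th12.
Qed.

End words.

(** * Averages and normal sequences *)

Section averages.
Context {R : realType}.
Implicit Types (u v : nat -> R) (l : R).

Lemma cvg_near_eq u v l : (\forall N \near \oo, u N = v N) ->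
  u N @[N --> \oo] --> l -> v N @[N --> \oo] --> l.
Proof. by move=> uv ul; apply: cvg_trans ul; exact: near_eq_cvg. Qed.

Lemma cvg_succ u l : u N.+1 @[N --> \oo] --> l <-> u N @[N --> \oo] --> l.
Proof. by rewrite (cvg_shiftS u). Qed.

Definition avg_cvg u l := (N%:R^-1 * \sum_(n < N) u n) @[N --> \oo] --> l.

Lemma avg_cvgD u v l m :
  avg_cvg u l -> avg_cvg v m -> avg_cvg (fun n => u n + v n) (l + m).
Proof.
rewrite /avg_cvg => ul vm; apply: (cvg_near_eq _ (cvgD ul vm)).
by near=> N; rewrite /= -mulrDr -big_split.
Unshelve. all: by end_near. Qed.

Lemma avg_cvgZ k u l : avg_cvg u l -> avg_cvg (fun n => k * u n) (k * l).
Proof.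
rewrite /avg_cvg => ul; apply: (cvg_near_eq _ (cvgM (cvg_cst k) ul)).
by near=> N; rewrite /= mulrCA mulr_sumr.
Unshelve. all: by end_near. Qed.

Lemma avg_cvg_cst l : avg_cvg (fun=> l) l.
Proof.
apply: cvg_near_cst; near=> N.
rewrite big_const_ord iter_addr_0 -[l *+ N]mulr_natl mulrA mulVf ?mul1r//.
by rewrite pnatr_eq0 -lt0n; near: N; exact: nbhs_infty_gt.
Unshelve. all: by end_near. Qed.

Lemma avg_cvg_sum (I : Type) (s : seq I) (u : I -> nat -> R) (l : I -> R) :
  (forall i, avg_cvg (u i) (l i)) ->
  avg_cvg (fun n => \sum_(i <- s) u i n) (\sum_(i <- s) l i).
Proof.
move=> ul; elim: s => [|i s ih].
  rewrite big_nil (_ : (fun n => _) = fun=> 0); first exact: avg_cvg_cst.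
  by apply/funext => n; rewrite big_nil.
rewrite big_cons.
rewrite (_ : (fun n => _) = fun n => u i n + \sum_(j <- s) u j n).
  exact: avg_cvgD.
by apply/funext => n; rewrite big_cons.
Qed.

(** The sum of the first [N] shifted terms and that of the first [N + 1] original terms differ by
    [u 0], and [N / (N + 1)] tends to 1. *)
Lemma avg_cvgS u l : avg_cvg (fun n => u n.+1) l <-> avg_cvg u l.
Proof.
rewrite /avg_cvg.
have inv0 : ((N.+1)%:R^-1 : R) @[N --> \oo] --> (0 : R) by exact: cvg_harmonic.
have ratio : ((N%:R / N.+1%:R) : R) @[N --> \oo] --> (1 : R).
  rewrite -[X in _ --> X]subr0.
  apply: (cvg_near_eq _ (cvgB (cvg_cst (1 : R)) inv0)).
  near=> N => /=; rewrite !fctE -natr1; field.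
  by rewrite natr1.
split=> ul.
  apply/cvg_succ.
  have := cvgD (cvgM ratio ul) (cvgM inv0 (cvg_cst (u 0))).
  rewrite mul1r mul0r addr0 => h; apply: (cvg_near_eq _ (h _ _ _ _)).
  near=> N.
  have N0 : N%:R != 0 :> R.
    by rewrite pnatr_eq0 -lt0n; near: N; exact: nbhs_infty_gt.
  rewrite ?fctE big_ord_recl /= ?fctE.
  have -> : \sum_(i < N) u (bump 0 i) = \sum_(i < N) u i.+1 by [].
  by move: (\sum_(i < N) _) => S; rewrite -!natr1; field; rewrite N0 natr1 pnatr_eq0.
have uS : (N.+1%:R^-1 * \sum_(n < N.+1) u n) @[N --> \oo] --> l.
  exact/(cvg_succ (fun N => N%:R^-1 * \sum_(n < N) u n)).
have ratio' : ((N.+1%:R / N%:R) : R) @[N --> \oo] --> (1 : R).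
  rewrite -[X in _ --> X]invr1.
  apply: (cvg_near_eq _ (cvgV (oner_neq0 _) ratio)).
  by near=> N => /=; rewrite ?fctE invf_div.
have invN : (N%:R^-1 : R) @[N --> \oo] --> (0 : R).
  exact/cvg_succ.
have := cvgB (cvgM ratio' uS) (cvgM invN (cvg_cst (u 0))).
rewrite mul1r mul0r subr0 => h; apply: (cvg_near_eq _ (h _ _ _ _)).
near=> N.
have N0 : N%:R != 0 :> R.
  by rewrite pnatr_eq0 -lt0n; near: N; exact: nbhs_infty_gt.
rewrite /= ?fctE /= big_ord_recl /=.
have -> : \sum_(i < N) u (bump 0 i) = \sum_(i < N) u i.+1 by [].
by move: (\sum_(i < N) _) => S; rewrite -!natr1; field; rewrite N0 natr1 pnatr_eq0.
Unshelve. all: by end_near. Qed.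

Lemma avg_cvg_shift u l m : avg_cvg (fun n => u (n + m)%N) l <-> avg_cvg u l.
Proof.
elim: m => [|m ih]; first by under eq_fun do rewrite addn0.
rewrite -ih -[X in _ <-> X]avg_cvgS.
by under eq_fun do rewrite addnS -addSn.
Qed.

Lemma avg_cvg_approx u l :
  (forall e, 0 < e -> exists v m,
     [/\ forall n, `|u n - v n| <= e, `|l - m| <= e & avg_cvg v m]) ->
  avg_cvg u l.
Proof.
move=> approx; apply/cvgrPdist_le => e e0.
have e3 : 0 < e / 3 by rewrite divr_gt0.
have [v [m [uv lm /cvgrPdist_le/(_ _ e3) vm]]] := approx _ e3.
near=> N.
have N0 : 0 < N%:R :> R by rewrite ltr0n; near: N; exact: nbhs_infty_gt.
have h1 : `|m - N%:R^-1 * \sum_(n < N) v n| <= e / 3 by near: N.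
have h2 : `|N%:R^-1 * \sum_(n < N) v n - N%:R^-1 * \sum_(n < N) u n| <= e / 3.
  rewrite -mulrBr -sumrB normrM gtr0_norm ?invr_gt0// mulrC ler_pdivrMr//.
  rewrite (le_trans (ler_norm_sum _ _ _))//.
  apply: (le_trans (_ : _ <= \sum_(i < N) (e / 3))).
    by apply: ler_sum => i _; rewrite distrC; exact: uv.
  by rewrite big_const_ord iter_addr_0 mulr_natr.
have -> : e = e / 3 + (e / 3 + e / 3) by field.
set S := N%:R^-1 * _ in h2 *; set S' := N%:R^-1 * _ in h1 h2.
rewrite -(subrKA m) (le_trans (ler_normD _ _))// lerD//.
by rewrite -(subrKA S') (le_trans (ler_normD _ _))// lerD.
Unshelve. all: by end_near. Qed.

End averages.

Section normality.
Context {R : realType} (F : eqType) (E : seq F).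
Hypothesis uniqE : uniq E.
Hypothesis allE : forall z, z \in E.
Hypothesis E0 : (0 < size E)%N.
Variable s : nat -> F.

Fixpoint past n : seq F := if n is m.+1 then s m :: past m else [::].

Lemma size_past n : size (past n) = n.
Proof. by elim: n => //= n ->. Qed.

Lemma walk_past (g : seq F -> F -> R) n :
  walk g (past n) = \sum_(i < n) g (past i) (s i).
Proof. by elim: n => [|n ih]; rewrite ?big_ord0// big_ord_recr /= ih. Qed.

Definition matches (w t : seq F) : R := (take (size w) t == w)%:R.

(** The martingale difference for the event that the latest digits spell [w] and the next one is
    [d]: its indicator minus its conditional probability for uniform digits. *)
Definition digit_bias (w : seq F) (d : F) (t : seq F) (d' : F) : R :=
  matches w t * ((d' == d)%:R - (size E)%:R^-1).

Lemma sum_digit_bias w d t : \sum_(d' <- E) digit_bias w d t d' = 0.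
Proof.
rewrite -mulr_sumr sumrB (bigD1_seq d)//= eqxx big1 ?addr0; last first.
  by move=> z /negbTE ->.
rewrite big_const_seq count_predT iter_addr_0 -[_^-1 *+ _]mulr_natl mulfV ?subrr ?mulr0//.
by rewrite pnatr_eq0 -lt0n.
Qed.

Lemma digit_bias_le1 w d t d' : `|digit_bias w d t d'| <= 1.
Proof.
have q1 : 0 <= ((size E)%:R^-1 : R) <= 1.
  by rewrite invr_ge0 ler0n invf_le1 ?ltr0n// ler1n.
rewrite /digit_bias /matches; case: eqP => _; last by rewrite mul0r normr0.
rewrite mul1r; move: q1 => /andP[h1 h2].
by case: eqP => _; rewrite ler_norml; apply/andP; split; rewrite /=; lra.
Qed.

(** Induction on the word: the frequency of [d :: w] is the mean of the bias of [d] after [w], which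
    vanishes, plus [1/q] times the frequency of [w]. *)
Lemma normal_frequency :
  (forall w d, avg_cvg (fun n => digit_bias w d (past n) (s n)) 0) ->
  forall w, avg_cvg (fun n => matches w (past n)) ((size E)%:R ^- size w).
Proof.
move=> bias; elim=> [|d w ih].
  rewrite expr0 invr1 /matches; under eq_fun do rewrite take0 eqxx.
  exact: avg_cvg_cst.
apply/avg_cvgS.
have := avg_cvgD (bias w d) (avg_cvgZ (k := (size E)%:R^-1) ih).
rewrite add0r /= exprS invfM; congr avg_cvg; apply/funext => n.
rewrite /digit_bias [in RHS]/matches /= eqseq_cons andbC -mulnb natrM /matches.
by ring.
Qed.

End normality.

(** * Haar measure on the plane *)

Section plane_topology.
Context {R : realType} {K : nonArchLocalFieldType R}.

Lemma nbhs_planeP (p : plane K) (A : set (plane K)) :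
  nbhs p A <-> exists2 e : R, 0 < e & forall p' : plane K,
    absv (p.1 - p'.1) < e -> absv (p.2 - p'.2) < e -> A p'.
Proof.
split=> [[[U V] /= [/nbhs_absvP[e e0 eU] /nbhs_absvP[d d0 dV]] UV]|[e e0 eA]].
  exists (Num.min e d); first by rewrite lt_min e0.
  move=> p'; rewrite !lt_min => /andP[h1 _] /andP[_ h2].
  by apply: (UV p'); split; [exact: eU|exact: dV].
exists ([set x | absv (p.1 - x) < e], [set x | absv (p.2 - x) < e]) => /=.
  by split; apply/nbhs_absvP; exists e.
by move=> [x y] /= [xe ye]; exact: eA.
Qed.

(** The radius is given by a scalar, so that discs are multiples of one another. *)
Definition disc (k : K) : set K := [set x | absv x <= absv k].

Definition box (k : K) : set (plane K) :=
  [set p | absv p.1 <= absv k /\ absv p.2 <= absv k].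

Lemma box1 : box 1 = @integral_square R K.
Proof. by rewrite /box absv1. Qed.

Definition tbox (k : K) (v : plane K) : set (plane K) :=
  [set p | plane_close (absv k) p v].

Lemma tboxE k v : tbox k v = [set v + p | p in box k].
Proof.
apply/seteqP; split=> [p [p1 p2]|_ [p [p1 p2] <-]]; last first.
  by split; rewrite [X in absv (X - _)]addrC addrK.
by exists (p - v) => //; rewrite addrC subrK.
Qed.

Lemma tbox0 k : tbox k 0 = box k.
Proof.
by apply/seteqP; split=> p [p1 p2]; split; move: p1 p2; rewrite !subr0.
Qed.

Lemma open_tbox k v : k != 0 -> open (tbox k v).
Proof.
rewrite -absv_gt0 => k0; rewrite openE => p pk.
apply/nbhs_planeP; exists (absv k) => // p' h1 h2.
by apply: plane_close_trans pk; apply/plane_closeC; split; exact: ltW.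
Qed.

Lemma open_measurable_borel (A : set (plane K)) :
  open A -> measurable (A : set (borel (plane K))).
Proof. exact: sub_gen_smallest. Qed.

Lemma measurable_tbox k v : k != 0 ->
  measurable (tbox k v : set (borel (plane K))).
Proof. by move=> k0; apply: open_measurable_borel; exact: open_tbox. Qed.

Lemma measurable_box k : k != 0 -> measurable (box k : set (borel (plane K))).
Proof. by move=> k0; rewrite -tbox0; exact: measurable_tbox. Qed.

Lemma closed_disc k : k != 0 -> closed (disc k).
Proof.
rewrite -absv_gt0 => k0 x cx; have [|y [yk]] := cx [set y | absv (x - y) < absv k].
  by apply/nbhs_absvP; exists (absv k).
by move=> /= xy; rewrite /disc /= -(subrK y x) absvD_le// ltW.
Qed.

Lemma continuous_mulK (k : K) : continuous (fun x : K => k * x).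
Proof.
move=> x A /nbhs_absvP[e e0 eA]; apply/nbhs_absvP.
exists (e / (absv k + 1)).
  by rewrite divr_gt0// ltr_wpDl// absv_ge0.
move=> y xy; apply: eA; rewrite -mulrBr absvM.
rewrite ltr_pdivlMr in xy; last by rewrite ltr_wpDl// absv_ge0.
apply: le_lt_trans xy; rewrite mulrC ler_wpM2l ?absv_ge0// lerDl.
exact: ler01.
Qed.

Lemma disc_scale k l : k != 0 -> disc (l * k) = [set l * x | x in disc k].
Proof.
move=> k0; have [->|l0] := eqVneq l 0.
  apply/seteqP; split=> [x|_ [y _ <-]]; rewrite /disc /= !mul0r absv0//.
  move=> x0; exists 0; rewrite ?mul0r ?absv0 ?absv_ge0//.
  by apply/esym/absv_eq0/eqP; rewrite eq_le x0 absv_ge0.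
have l0' : 0 < absv l by rewrite absv_gt0.
apply/seteqP; split=> [x|_ [y yk <-]]; rewrite /disc /= absvM; last first.
  by rewrite absvM ler_pM2l.
move=> xlk; exists (l^-1 * x); last by rewrite mulrA mulfV ?mul1r.
by rewrite absvM absvV mulrC ler_pdivrMr// mulrC.
Qed.

(** A compact neighbourhood of 0 contains some disc, small radii being available because the
    absolute value is nontrivial; every disc is the image of that one under a multiplication. *)
Lemma compact_disc k : compact (disc k).
Proof.
have := @absv_locally_compact R K 0 I => -[U].
rewrite /within /= => U0 [cU clU].
have /nbhs_absvP[e e0 eU] : nbhs (0 : K) U.
  by apply: filterS U0 => x; apply.
have [u u0 ue] : exists2 u : K, u != 0 & absv u < e.
  have [x [x0 x1]] := @absv_nontrivial R K.
  have {x0 x1} [y y0 y1] : exists2 y : K, y != 0 & absv y < 1.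
    have [lt|gt|//] := ltgtP (absv x) 1; first by exists x => //; apply/eqP.
    exists x^-1; first by rewrite invr_eq0; apply/eqP.
    by rewrite absvV invf_lt1// (lt_trans _ gt).
  have y01 : 0 <= absv y < 1 by rewrite absv_ge0.
  have [m] := expr_lt_exists y01 e0.
  by rewrite -absvX => ym; exists (y ^+ m) => //; exact: expf_neq0.
have cu : compact (disc u).
  apply: (subclosed_compact (closed_disc u0) cU) => x xu; apply: eU.
  by rewrite sub0r absvN; exact: le_lt_trans xu ue.
rewrite -(divfK u0 k) disc_scale//; apply: continuous_compact => //.
by apply: continuous_subspaceT; exact: continuous_mulK.
Qed.

Lemma compact_box k : compact (box k).
Proof.
have h : compact (disc k `*` disc k) by apply: compact_setX; exact: compact_disc.
exact: h.
Qed.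

(** Heine-Cantor, with only one of the two points confined to the compact box. *)
Lemma box_unif_continuous k (f : plane K -> R) (e : R) : continuous f -> 0 < e ->
  exists2 d, 0 < d & forall u v, box k u -> plane_close d u v ->
    `|f u - f v| <= e.
Proof.
move=> cf e0.
have /compact_near_coveringP near_cover := @compact_box k.
pose P (d : R) (u : plane K) := forall v, plane_close d u v -> `|f u - f v| <= e.
have [d [d0 dP]] : exists d, 0 < d /\ box k `<=` P d.
  have near_P : \forall d \near (0 : R)^'+, box k `<=` P d.
    apply: near_cover => u _.
    have e2 : 0 < e / 2 by rewrite divr_gt0.
    have /cf/nbhs_planeP[r r0 rP] : nbhs (f u) [set y | `|f u - y| < e / 2].
      exact: nbhsx_ballx.
    exists ([set x | absv (u.1 - x.1) < r /\ absv (u.2 - x.2) < r], [set d | d < r]).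
      split => /=; last exact: nbhs_right_lt.
      by apply/nbhs_planeP; exists r.
    move=> [x d] /= [[x1 x2] dr] v [v1 v2].
    have lt (y z w : K) : absv (y - z) < r -> absv (z - w) <= d ->
        absv (y - w) < r.
      move=> yz zw; have [h|h] := leP (absv (y - z)) d.
        by rewrite (le_lt_trans _ dr)// (absvB_trans h).
      by rewrite (le_lt_trans _ yz)// (absvB_trans (lexx _))// (le_trans zw)// ltW.
    have fx := rP _ x1 x2; have fv := rP _ (lt _ _ _ x1 v1) (lt _ _ _ x2 v2).
    rewrite /= in fx fv.
    have -> : e = e / 2 + e / 2 by field.
    rewrite -(subrKA (f u)) (le_trans (ler_normD _ _))// lerD ?(ltW fv)//.
    by rewrite distrC ltW.
  near (0 : R)^'+ => d; exists d; split; first by near: d; exact: nbhs_right_gt.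
  by near: d.
by exists d => // u v uk; exact: dP.
Unshelve. all: by end_near. Qed.

End plane_topology.

Section haar.
Context {R : realType} {K : nonArchLocalFieldType R} (pi : uniformizer K).
Local Notation q := (residue_card pi).
Local Notation c := (q%:R^-1 : R).
Hypothesis absv_pi : absv (pi : K) = c.
Variable lambda : {measure set (borel (plane K)) -> \bar R}.
Hypothesis haar : haar_measure lambda.

Lemma absv_unif_expV_ge (e : R) : exists n, e <= absv ((pi : K) ^- n).
Proof.
have [e0|e0] := leP e 0; first by exists 0; rewrite (le_trans e0) ?absv_ge0.
have [c0 c1] := andP (inv_card_lt01 absv_pi).
have eV0 : 0 < e^-1 by rewrite invr_gt0.
have [n ne] := expr_lt_exists (inv_card_ge01 absv_pi) eV0.
exists n; rewrite absvV absvX absv_pi -[e]invrK lef_pV2 ?posrE ?ltW//.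
by rewrite exprn_gt0.
Qed.

Lemma haar_tbox k v : k != 0 -> lambda (tbox k v) = lambda (box k).
Proof.
by move=> k0; rewrite tboxE; case: haar => _ _; apply; exact: measurable_box.
Qed.

Lemma haar_box_lty k : (lambda (box k) < +oo)%E.
Proof. by case: haar => _ + _; apply; exact: compact_box. Qed.

(** The digits of the two coordinates divided by [k] split the box into [q^2] disjoint translates of
    the box smaller by the factor [pi]. *)
Lemma haar_box_unif (k : K) : k != 0 ->
  lambda (box k) = ((q ^ 2)%:R%:E * lambda (box (k * (pi : K))%R))%E.
Proof.
move=> k0.
have kpi0 : k * (pi : K) != 0 by rewrite mulf_neq0// (unif_neq0K pi).
pose r := [seq (z, w) | z <- residues pi, w <- residues pi].
pose A (i : residue_field pi * residue_field pi) :=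
  tbox (k * (pi : K)) (k * digit_rep i.1, k * digit_rep i.2).
have uniq_r : uniq r.
  by apply: allpairs_uniq; rewrite ?uniq_residues// => -[? ?] [? ?].
have all_r i : i \in r.
  by case: i => z w; apply/allpairsP; exists (z, w); rewrite !(mem_residues absv_pi).
have close_unif (z : residue_field pi) (x : K) : absv x <= absv k ->
    (absv (x - k * digit_rep z) <= absv (k * (pi : K))) = (dig pi (x / k) == z).
  have k0' : 0 < absv k by rewrite absv_gt0.
  move=> xk; have xk1 : absv (x / k) <= 1.
    by rewrite absvM absvV ler_pdivrMr// mul1r.
  have [z1 dz] := digit_repP absv_pi z.
  have -> : x - k * digit_rep z = k * (x / k - digit_rep z).
    by rewrite mulrBr mulrCA mulfV ?mulr1.
  rewrite !absvM ler_pM2l// absv_pi -{2}dz.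
  by apply/idP/eqP; move=> /(dig_eq absv_pi xk1 z1).
have absvk (x : K) (z : residue_field pi) :
    absv (x - k * digit_rep z) <= absv (k * (pi : K)) -> absv x <= absv k.
  move=> h; rewrite -(subrK (k * digit_rep z) x); apply: absvD_le.
    by rewrite (le_trans h)// absvM ler_piMr ?absv_ge0// ltW// (unif_lt1 pi).
  by rewrite absvM ler_piMr ?absv_ge0//; have [] := digit_repP absv_pi z.
have -> : box k = \bigcup_(i in [set` r]) A i.
  apply/seteqP; split=> [p [p1 p2]|p [[z w] _]].
    exists (dig pi (p.1 / k), dig pi (p.2 / k)); first exact: all_r.
    by split => /=; rewrite close_unif.
  by move=> [/= /absvk p1 /absvk p2].
rewrite measure_fin_bigcup; last 3 first.
- exact: finite_seq.
- apply/trivIsetP => -[z w] [z' w'] _ _; apply: contraNeq => /set0P[p [[]]].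
  move=> /= p1 p2 [/= p1' p2'].
  move: p1 p2 p1' p2' (absvk _ _ p1) (absvk _ _ p2) => + + + + h1 h2.
  by rewrite !close_unif// => /eqP -> /eqP -> /eqP -> /eqP ->.
- by move=> i _; exact: measurable_tbox.
rewrite -fsbig_seq//.
rewrite (eq_bigr (fun=> lambda (box (k * (pi : K))%R))); last first.
  by move=> i _; exact: haar_tbox.
rewrite big_const_seq count_predT size_allpairs size_residues -mulnn.
by elim: (q * q)%N => [|n ih]; rewrite ?mul0e// iterS ih mulrS EFinD ge0_muleDl// mul1e.
Qed.

Lemma haar_box_unifX (k : K) n : k != 0 ->
  lambda (box k) = ((q ^ (2 * n))%:R%:E * lambda (box (k * (pi : K) ^+ n)%R))%E.
Proof.
move=> k0; elim: n => [|n ih]; first by rewrite expn0 mul1e mulr1.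
rewrite ih haar_box_unif; last first.
  by rewrite mulf_neq0 ?expf_neq0// (unif_neq0K pi).
by rewrite muleA -EFinM -natrM -expnD mulnS addnC exprSr mulrA.
Qed.

(** Otherwise all boxes of scale [pi^-n], which exhaust the plane, would be null. *)
Lemma haar_box1_gt0 : (0 < lambda (box 1%R))%E.
Proof.
rewrite lt0e measure_ge0 andbT; apply/eqP => box0.
have pi0 := unif_neq0K pi.
have boxn0 n : lambda (box ((pi : K) ^- n)) = 0%E.
  rewrite (haar_box_unifX n) ?invr_neq0 ?expf_neq0//.
  by rewrite mulVf ?expf_neq0// box0 mule0.
have [/eqP + _ _] := haar; apply/negP; rewrite negbK.
have -> : [set: borel (plane K)] = \bigcup_n (box ((pi : K) ^- n)).
  apply/seteqP; split => // p _.
  have mono (n n' : nat) : (n <= n')%N -> absv ((pi : K) ^- n) <= absv ((pi : K) ^- n').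
    have [c0 c1] := andP (inv_card_lt01 absv_pi).
    move=> nn'; rewrite !absvV !absvX absv_pi lef_pV2 ?posrE ?exprn_gt0//.
    by apply: ler_wiXn2l; rewrite ?ltW.
  have [n1 p1] := absv_unif_expV_ge (absv p.1).
  have [n2 p2] := absv_unif_expV_ge (absv p.2).
  exists (maxn n1 n2) => //; split.
    by rewrite (le_trans p1)// mono// leq_maxl.
  by rewrite (le_trans p2)// mono// leq_maxr.
have mbox n : measurable (box ((pi : K) ^- n) : set (borel (plane K))).
  by apply: measurable_box; rewrite invr_neq0 ?expf_neq0.
apply/eqP; apply: measure_negligible; first exact: bigcup_measurable.
apply: negligible_bigcup => n; exists (box ((pi : K) ^- n)); split => //.
Qed.

End haar.

(** * Null sets of orbits *)

Lemma measure_bigsetU_le d (T : measurableType d) (R : realType)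
    (mu : {measure set T -> \bar R}) (I : Type) (s : seq I) (A : I -> set T)
    (e : R) :
  (forall i, measurable (A i)) -> (forall i, (mu (A i) <= e%:E)%E) ->
  measurable (\big[setU/set0]_(i <- s) A i) /\
  (mu (\big[setU/set0]_(i <- s) A i) <= ((size s)%:R * e)%:E)%E.
Proof.
move=> mA Ae; elim: s => [|i s [ms ih]].
  by rewrite big_nil measure0 mul0r; split.
rewrite big_cons; split; first exact: measurableU.
rewrite (le_trans (measureU2 _ _ _))// /= -natr1 mulrDl mul1r addrC EFinD.
exact: leeD.
Qed.

Lemma nneseries_geometric_lty (R : realType) (u : nat -> \bar R) (a r : R) :
  0 <= a -> 0 < r < 1 -> (forall n, (0 <= u n)%E) ->
  (forall n, (u n <= (a * r ^+ n)%:E)%E) -> (\sum_(n <oo) u n < +oo)%E.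
Proof.
move=> a0 /andP[r0 r1] u0 ua.
apply: (@le_lt_trans _ _ (a * (1 - r)^-1)%:E); last exact: ltry.
apply: lime_le; first exact: is_cvg_nneseries.
apply: nearW => n.
apply: le_trans (lee_sum _ (fun i _ => ua i)) _.
rewrite sumEFin lee_fin.
have := @geometric_le_lim R n a r a0 r0.
by rewrite ger0_norm ?(ltW r0)// => /(_ r1).
Qed.

Section null_sets.
Context {R : realType} {K : nonArchLocalFieldType R} (pi : uniformizer K).
Variables a b : K.
Local Notation q := (residue_card pi).
Local Notation F := (residue_field pi).
Local Notation c := (q%:R^-1 : R).
Local Notation T := (T_map pi a b).
Local Notation square := (@integral_square R K).
Local Notation words := (words (residues pi)).
Hypothesis absv_pi : absv (pi : K) = c.
Hypothesis absv_a : 0 < absv a < 1.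
Hypothesis absv_b : absv b = q%:R.
Variable lambda : {measure set (borel (plane K)) -> \bar R}.
Hypothesis haar : haar_measure lambda.

Definition digits (p : plane K) (n : nat) : F := dig pi (iter n T p).1.

Lemma past_inj (s s' : nat -> F) N : past s N = past s' N ->
  forall i, (i < N)%N -> s i = s' i.
Proof.
elim: N => [|N ih] //= [sN /ih h] i; rewrite ltnS leq_eqVlt => /predU1P[->//|].
exact: h.
Qed.

(** This is [orbits_close] at index 1, for segments indexed from the second coordinate: the bound
    there is the larger of [c ^+ N] and [c * |p.2 - p'.2|]. *)
Lemma coding_inj p p' N : square p -> square p' ->
  past (digits p) N = past (digits p') N ->
  absv (p.2 - p'.2) <= c ^+ N -> absv (p.1 - p'.1) <= c ^+ N.
Proof.
move=> sp sp' /past_inj pp' p2.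
pose u (p : plane K) i := if i is j.+1 then (iter j T p).1 else p.2.
have uE p0 j : iter j T p0 = (u p0 j.+1, u p0 j).
  by case: j => [|j]; rewrite [LHS]surjective_pairing.
have u1 p0 i : square p0 -> absv (u p0 i) <= 1.
  by move=> /(iter_T_square absv_pi absv_a absv_b i); rewrite uE => -[].
have rec p0 i : recurrent pi a b (u p0 i) (u p0 i.+1) (u p0 i.+2).
  by have := uE p0 i.+1; rewrite iterS uE /T_map /= => -[].
have := @orbits_close _ _ _ _ _ absv_pi absv_a absv_b N (u p) (u p')
  (fun i _ => conj (u1 p i sp) (u1 p' i sp'))
  (fun i iN => And3 (rec p i) (rec p' i) (pp' i iN)) 1 isT.
move=> /= h; apply: le_trans h _; rewrite subn1 expr1 ge_max lexx /=.
rewrite (le_trans _ p2)// ler_piMl ?absv_ge0// ltW//.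
exact: inv_card_lt1.
Qed.

(** Finite [pi]-adic expansions, units digit first; those of length [N] represent all classes modulo
    [pi^N]. *)
Fixpoint expansion (w : seq F) : K :=
  if w is z :: w' then digit_rep z + (pi : K) * expansion w' else 0.

Lemma expansion_dense (x : K) N : absv x <= 1 ->
  exists2 w, w \in words N & absv (x - expansion w) <= c ^+ N.
Proof.
have allE := mem_residues absv_pi.
elim: N x => [|N ih] x x1; first by exists [::]; rewrite ?inE//= subr0.
have [z1 dz] := digit_repP absv_pi (dig pi x).
have pi0 := unif_neq0K pi.
have xz : absv (x - digit_rep (dig pi x)) <= absv (pi : K).
  by rewrite absv_pi; apply/(dig_eq absv_pi).
have [|w wN wx] := ih ((x - digit_rep (dig pi x)) / (pi : K)).
  by rewrite absvM absvV ler_pdivrMr ?mul1r// absv_gt0.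
exists (dig pi x :: w).
  by rewrite (mem_words allE)/= eqSS -(mem_words allE).
have -> : x - expansion (dig pi x :: w) =
    (pi : K) * ((x - digit_rep (dig pi x)) / (pi : K) - expansion w).
  by rewrite mulrBr mulrCA mulfV// mulr1 /= opprD addrA.
by rewrite absvM exprS absv_pi ler_wpM2l// ltW// inv_card_gt0.
Qed.

(* By [coding_inj], a word of length N and the class of the second coordinate *)
(* modulo pi^N confine [iter m T p] to one translate of [box (pi^N)], hence p *)
(* to a translate of [box (kappa * pi^N)], kappa bounding the Lipschitz       *)
(* constant of the inverse of [iter m T]. There are q^N classes while such a  *)
(* box has q^(-2N) of the measure of [box kappa].                             *)
Lemma bad_words_cover m : exists2 L : R, 0 <= L &
  forall (bad : pred (seq F)) N, exists B : set (borel (plane K)),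
    [/\ measurable B,
      forall p, square (iter m T p) -> bad (past (digits (iter m T p)) N) ->
        B p &
      (lambda B <= (L * (q%:R ^- N * (count bad (words N))%:R))%:E)%E].
Proof.
have allE := mem_residues absv_pi.
have [C C1 [_ lip]] := T_inv_lipschitz a absv_b m.
have [c0 c1] := andP (inv_card_lt01 absv_pi).
have [k kC] := absv_unif_expV_ge absv_pi C.
pose kappa := (pi : K) ^- k.
have pi0 := unif_neq0K pi.
have kappa0 : kappa != 0 by rewrite invr_neq0 ?expf_neq0.
have box_fin : lambda (box kappa) \is a fin_num.
  by rewrite ge0_fin_numE// (haar_box_lty haar).
exists (fine (lambda (box kappa))); first exact: fine_ge0.
move=> bad N.
pose k' := kappa * (pi : K) ^+ N.
have k'0 : k' != 0 by rewrite mulf_neq0 ?expf_neq0.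
pose good i p := [/\ square (iter m T p), past (digits (iter m T p)) N = i.1 &
  absv ((iter m T p).2 - expansion i.2) <= c ^+ N].
pose p0 i := xget 0 [set p | good i p].
pose r := [seq (t, d) | t <- [seq t <- words N | bad t], d <- words N].
exists (\big[setU/set0]_(i <- r) tbox k' (p0 i)).
have boxN : (lambda (box k') <= (fine (lambda (box kappa)) / q%:R ^+ (2 * N))%:E)%E.
  have := haar_box_unifX absv_pi haar N kappa0; rewrite -/k'.
  have q0 : 0 < q%:R ^+ (2 * N) :> R by rewrite exprn_gt0// -invr_gt0.
  move=> ->; have fk' : lambda (box k') \is a fin_num.
    by rewrite ge0_fin_numE// (haar_box_lty haar).
  rewrite fineM// /= natrX mulrC mulKf ?gt_eqF//.
  by rewrite fineK.
have mt i : measurable (tbox k' (p0 i) : set (borel (plane K))).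
  exact: measurable_tbox.
have le i : (lambda (tbox k' (p0 i)) <=
    (fine (lambda (box kappa)) / q%:R ^+ (2 * N))%:E)%E.
  by rewrite (haar_tbox haar).
have [mB leB] := measure_bigsetU_le r mt le.
split=> //; last first.
  apply: le_trans leB _; rewrite lee_fin /r size_allpairs size_filter.
  rewrite size_words size_residues natrM natrX.
  have q0 : q%:R != 0 :> R by rewrite gt_eqF// -invr_gt0.
  have qN0 : (q%:R : R) ^+ N != 0 by rewrite expf_neq0.
  rewrite mul2n -addnn exprD le_eqVlt; apply/orP; left; apply/eqP.
  move: (q%:R ^+ N) qN0 (count _ _)%:R (fine _) => Q Q0 u v; field.
  exact: Q0.
move=> p sp bp.
have [w wN pw] := expansion_dense N sp.2.
have gp : good (past (digits (iter m T p)) N, w) p by [].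
have gp0 : good (past (digits (iter m T p)) N, w)
    (p0 (past (digits (iter m T p)) N, w)).
  by rewrite /p0; apply: (xgetPex 0); exists p.
rewrite -bigcup_seq; exists (past (digits (iter m T p)) N, w).
  apply/allpairsP; exists (past (digits (iter m T p)) N, w); split => //=.
  by rewrite mem_filter bp (mem_words allE) size_past eqxx.
move: gp0; set p' := p0 _ => -[/= sp' pp' p'2].
have close2 : absv ((iter m T p).2 - (iter m T p').2) <= c ^+ N.
  by rewrite (absvB_trans pw)// absvBC.
have close1 := coding_inj sp sp' (esym pp') close2.
have := lip _ _ _ sp sp' (conj close1 close2).
have TK p1 : iter m (T_inv pi a b) (iter m T p1) = p1.
  by elim: (m) p1 => // n ih p1; rewrite iterSr iterS (T_mapK _ _ absv_a) ih.
rewrite !TK => -[h1 h2].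
suff le_k' : C * c ^+ N <= absv k' by split; exact: le_trans le_k'.
by rewrite absvM absvX absv_pi ler_wpM2r// exprn_ge0// ltW.
Qed.

(** Borel-Cantelli: by [count_walk_ge] the coverings of the words of length [N] with a large walk
    have measures decaying geometrically in [N]. *)
Lemma null_walk_ge (g : seq F -> F -> R) (e : R) m :
  (forall t, \sum_(d <- residues pi) g t d = 0) -> (forall t d, `|g t d| <= 1) ->
  0 < e <= 2 ->
  lambda.-negligible [set p | square (iter m T p) /\
    forall n, exists2 N, (n <= N)%N &
      e * N%:R <= walk g (past (digits (iter m T p)) N)].
Proof.
move=> g0 g1 e02; have [L L0 cover] := bad_words_cover m.
have /choice[B BP] := fun N => cover (fun w => e * N%:R <= walk g w) N.
exists (lim_sup_set B); split.
- apply: bigcap_measurable => [|n _]; first by exists 0%N.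
  by apply: bigcup_measurable => k _; case: (BP k).
- apply: lim_sup_set_cvg0; first by move=> k; case: (BP k).
  have rho : 0 < expR (- (e ^+ 2 / 8)) < 1.
    rewrite expR_gt0 expR_lt1 oppr_lt0 divr_gt0// exprn_gt0//.
    by case/andP: e02.
  apply: (nneseries_geometric_lty L0 rho) => N; first exact: measure_ge0.
  have [_ _ leB] := BP N; apply: (le_trans leB); rewrite lee_fin ler_wpM2l//.
  have q0 : 0 < q%:R ^+ N :> R.
    by rewrite exprn_gt0// -invr_gt0 (inv_card_gt0 absv_pi).
  rewrite mulrC ler_pdivrMr//.
  apply: le_trans (count_walk_ge (mem_residues absv_pi) g0 g1 N e02) _.
  by rewrite size_residues mulrC.
- move=> p [sp h] n _; have [N nN hN] := h n.
  by exists N => //; case: (BP N) => _ hB _; exact: hB.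
Qed.

End null_sets.

(** * The Bernoulli measure on bisequences *)

Section bisequences.
Context {R : realType} {K : nonArchLocalFieldType R} (pi : uniformizer K).
Local Notation q := (residue_card pi).
Local Notation F := (residue_field pi).
Local Notation c := (q%:R^-1 : R).
Local Notation words := (words (residues pi)).
Hypothesis absv_pi : absv (pi : K) = c.
Implicit Types s t : bisequence pi.

Lemma nbhs_cylinder M s : nbhs s (cylinder M s).
Proof.
have coord k : nbhs s [set s' : bisequence pi | s' k = s k].
  have := @proj_continuous int (fun=> discrete_topology F) k s [set s k].
  by apply; exact/principal_filterP.
elim: M => [|M ih].
  apply: filterS (coord 0) => s' /= h k; rewrite leqn0 absz_eq0 => /eqP ->.
  exact: h.
apply: filterS (filterI ih (filterI (coord M.+1%:Z) (coord (- M.+1%:Z)))).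
move=> s' [h [h1 h2]] k kM; have [kM'|kM'] := leqP (absz k) M; first exact: h.
have [->|->] : k = M.+1%:Z \/ k = - M.+1%:Z by lia.
  exact: h1.
exact: h2.
Qed.

Lemma open_cylinder M t : open (cylinder M t).
Proof.
rewrite openE => s st; apply: filterS (nbhs_cylinder M s) => s' ss' k kM.
by rewrite ss'// st.
Qed.

(** The filter generated by the cylinders around [s] converges to [s] in each coordinate, hence in
    the product topology. *)
Lemma nbhs_bisequence s (A : set (bisequence pi)) : nbhs s A ->
  exists M, cylinder M s `<=` A.
Proof.
have sub m n : (m <= n)%N -> cylinder n s `<=` cylinder m s.
  by move=> mn s' h k km; apply: h; exact: leq_trans km mn.
pose G : set_system (bisequence pi) := filter_from [set: nat] (fun M => cylinder M s).
have FG : ProperFilter G.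
  apply: filter_from_proper; last by move=> M _; exists s.
  apply: filter_from_filter; first by exists 0.
  move=> m n _ _; exists (maxn m n) => // s' h.
  by split; apply: sub h; rewrite ?leq_maxl ?leq_maxr.
suff Gs : G --> s by move=> /Gs[M _ h]; exists M.
have := @pointwise_cvgP (discrete_topology int) (discrete_topology F) G s _.
move=> [_]; apply => k A' /= h; exists (absz k) => // s' /= /(_ k (leqnn _)) ss'.
by apply: h; rewrite /= ss'.
Qed.

(** The word is read from index [M] down to [-M], most recent digit first as in [words]; the values
    beyond [|k| <= M] are arbitrary. *)
Definition of_window M (w : seq F) : bisequence pi :=
  fun k => nth 0 w (absz (M%:Z - k)).

Definition window M s : seq F := mkseq (fun j => s (M%:Z - j%:Z)) (M.*2).+1.

Lemma size_window M s : size (window M s) = (M.*2).+1.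
Proof. exact: size_mkseq. Qed.

Lemma window_eqP M s t : window M s = window M t <-> cylinder M t s.
Proof.
split=> [h k kM|h]; last first.
  apply/eq_in_map => j; rewrite mem_iota add0n => /= jM.
  by apply: h; lia.
have /(congr1 (fun w => nth 0 w (absz (M%:Z - k)))) := h.
have jM : (absz (M%:Z - k) < (M.*2).+1)%N by lia.
rewrite !nth_mkseq//.
by have -> : M%:Z - (absz (M%:Z - k))%:Z = k by lia.
Qed.

Lemma window_of_window M w : size w = (M.*2).+1 -> window M (of_window M w) = w.
Proof.
move=> sw; apply: (@eq_from_nth _ 0); rewrite size_window// => j jM.
rewrite nth_mkseq// /of_window; congr nth; lia.
Qed.

Lemma measurable_cylinder M t :
  measurable (cylinder M t : set (borel (bisequence pi))).
Proof. apply: sub_gen_smallest; exact: open_cylinder. Qed.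

(** The empty and the full set are included so that this is an intersection-closed family covering
    the space, as the uniqueness theorem for measures requires. *)
Definition cylinders : set (set (bisequence pi)) :=
  [set A | A = set0 \/ A = setT \/ exists M t, A = cylinder M t].

(** An open set is the union over [M] of the cylinders of radius [M] inside it, finitely many for
    each [M]. *)
Lemma borel_bisequenceE :
  @measurable _ (borel (bisequence pi)) = <<s cylinders >>.
Proof.
apply/seteqP; split; last first.
  apply: smallest_sub; first exact: smallest_sigma_algebra.
  move=> _ [->|[->|[M [t ->]]]]; [exact: measurable0|exact: measurableT|].
  exact: measurable_cylinder.
apply: smallest_sub; first exact: smallest_sigma_algebra.
move=> A openA.
have -> : A = \bigcup_M \bigcup_(w in
    [set w | w \in words (M.*2).+1 /\ cylinder M (of_window M w) `<=` A])
    cylinder M (of_window M w).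
  apply/seteqP; split=> [s As|s [M _ [w [_ wA] ws]]]; last exact: wA.
  have [M MA] : exists M, cylinder M s `<=` A.
    by apply: nbhs_bisequence; apply: open_nbhs_nbhs.
  have E t : cylinder M (of_window M (window M s)) t <-> cylinder M s t.
    by rewrite -!window_eqP window_of_window// size_window.
  exists M => //; exists (window M s); last exact/E.
  split; last by move=> t /E; exact: MA.
  by rewrite (mem_words (mem_residues absv_pi)) size_window.
pose S := g_sigma_algebraType cylinders.
suff : measurable (\bigcup_M \bigcup_(w in
    [set w | w \in words (M.*2).+1 /\ cylinder M (of_window M w) `<=` A])
    (cylinder M (of_window M w) : set S)) by [].
apply: bigcup_measurable => M _; apply: fin_bigcup_measurable.
  apply: (sub_finite_set (B := [set` words (M.*2).+1])); last exact: finite_seq.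
  by move=> w [].
by move=> w _; apply: sub_gen_smallest; right; right; exists M, (of_window M w).
Qed.

Lemma cylinders_setI : setI_closed cylinders.
Proof.
move=> _ _ [->|[->|[M [t ->]]]] [->|[->|[N [u ->]]]]; rewrite ?set0I ?setI0 ?setTI ?setIT.
1-4: by left.
- by right; left.
- by right; right; exists N, u.
- by left.
- by right; right; exists M, t.
have [-> |/set0P[s [st su]]] := eqVneq (cylinder M t `&` cylinder N u) set0.
  by left.
right; right; exists (maxn M N), s; apply/seteqP; split=> [s' [h1 h2] k|s' h].
  by rewrite leq_max => /orP[kM|kN]; [rewrite h1// st|rewrite h2// su].
by split=> k kM; [rewrite h ?st// leq_max kM|rewrite h ?su// leq_max kM orbT].
Qed.

Definition shift s : bisequence pi := fun k => s (k + 1).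

(** The preimage prescribes the coordinates from [-M + 1] to [M + 1]; in the symmetric window of
    radius [M + 1] the two lowest remain free, which gives [q^2] disjoint cylinders. *)
Lemma shift_preimage_cylinder M t :
  let ext (i : F * F) : bisequence pi := fun k =>
    if k == - (M.+1)%:Z then i.1 else if k == - M%:Z then i.2 else t (k - 1) in
  shift @^-1` cylinder M t =
    \bigcup_(i in [set` [seq (z, w) | z <- residues pi, w <- residues pi]])
      cylinder M.+1 (ext i) /\
  trivIset [set: F * F] (fun i => cylinder M.+1 (ext i)).
Proof.
move=> ext; split.
  apply/seteqP; split=> [s h|s [[z w] _ h] k kM]; last first.
    rewrite /shift h /ext; last by lia.
    have -> : (k + 1 == - (M.+1)%:Z) = false by apply/eqP; lia.
    have -> : (k + 1 == - M%:Z) = false by apply/eqP; lia.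
    by rewrite addrK.
  exists (s (- (M.+1)%:Z), s (- M%:Z)).
    by apply/allpairsP; exists (s (- (M.+1)%:Z), s (- M%:Z)); rewrite !mem_residues.
  move=> k kM; rewrite /ext; case: eqP => [->//|k1]; case: eqP => [->//|k2].
  by rewrite -h; [rewrite /shift subrK|lia].
apply/trivIsetP => -[z w] [z' w'] _ _; apply: contraNeq => /set0P[s [h h']].
have M1 : (absz (- (M.+1)%:Z) <= M.+1)%N by lia.
have M2 : (absz (- M%:Z) <= M.+1)%N by lia.
have := h _ M1; rewrite (h' _ M1) /ext eqxx /= => ->.
have := h _ M2; rewrite (h' _ M2) /ext.
have -> : (- M%:Z == - (M.+1)%:Z) = false by apply/eqP; lia.
by rewrite eqxx /= => ->.
Qed.

Lemma measurable_shift :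
  measurable_fun setT (shift : borel (bisequence pi) -> borel (bisequence pi)).
Proof.
apply: (measurability _ borel_bisequenceE) => _ [_ [->|[->|[M [t ->]]]] <-].
- by rewrite preimage_set0 setI0; exact: measurable0.
- by rewrite preimage_setT setIT; exact: measurableT.
rewrite setTI; have [-> _] := shift_preimage_cylinder M t.
apply: fin_bigcup_measurable; first exact: finite_seq.
by move=> i _; exact: measurable_cylinder.
Qed.

Variable mu : probability (borel (bisequence pi)) R.
Hypothesis bernoulli : uniform_bernoulli mu.

Lemma bernoulli_shift (A : set (borel (bisequence pi))) :
  measurable A -> mu (shift @^-1` A) = mu A.
Proof.
have [X XE] : exists X : {mfun borel (bisequence pi) >-> borel (bisequence pi)},
    X = shift :> (bisequence pi -> bisequence pi).
  by exists (mfun_Sub (mem_set measurable_shift)).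
move=> mA; rewrite -XE -[LHS]/(distribution mu X A); apply/esym.
apply: (@measure_unique _ R (borel (bisequence pi)) cylinders (fun=> setT)
  borel_bisequenceE cylinders_setI _ _ mu (distribution mu X)) => //.
- by move=> _; right; left.
- exact: bigcup_const.
- move=> _ [->|[->|[M [t ->]]]].
  + by rewrite !measure0.
  + exact: etrans (probability_setT mu) (esym (probability_setT (distribution mu X))).
  have [E triv] := shift_preimage_cylinder M t.
  transitivity (mu (shift @^-1` cylinder M t)); last by rewrite -XE.
  rewrite E measure_fin_bigcup; last 3 first.
  - exact: finite_seq.
  - exact: sub_trivIset triv.
  - by move=> i _; exact: measurable_cylinder.
  rewrite -fsbig_seq; last first.
    apply: allpairs_uniq; first exact: uniq_residues.
      exact: uniq_residues.
    by move=> [? ?] [? ?].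
  rewrite (eq_bigr (fun=> (q%:R ^- (2 * M.+1 + 1))%:E)); last first.
    by move=> i _; exact: bernoulli.
  transitivity ((q%:R ^- (2 * M + 1))%:E : \bar R); first exact: bernoulli.
  apply: esym.
  rewrite sumEFin big_const_seq count_predT size_allpairs size_residues.
  rewrite iter_addr_0; congr EFin; rewrite -[LHS]mulr_natl mulnn.
  have q0 : (q%:R : R) != 0 by rewrite gt_eqF// -invr_gt0 (inv_card_gt0 absv_pi).
  have -> : (2 * M.+1 + 1 = (2 * M + 1) + 2)%N by lia.
  by rewrite exprD invfM natrX mulrCA mulfV ?mulr1// expf_neq0.
- by move=> k; rewrite [X in (X < _)%E]probability_setT ltry.
Qed.

Lemma bounded_integrable (f : borel (bisequence pi) -> R) (k : R) :
  measurable_fun setT f -> (forall s, `|f s| <= k) ->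
  mu.-integrable setT (EFin \o f).
Proof.
move=> mf fk; apply: measurable_bounded_integrable => //.
  by rewrite (@le_lt_trans _ _ 1%E) ?ltry// probability_le1.
exists k; split; first exact: num_real.
by move=> k' kk' s _; exact: le_trans (fk s) (ltW kk').
Qed.

(** A function of the window is a finite combination of indicators of cylinders of equal measure. *)
Lemma bernoulli_window_sum M (f : seq F -> R) :
  mu.-integrable setT (EFin \o (fun s : borel (bisequence pi) => f (window M s))) /\
  \int[mu]_s f (window M s) =
    \sum_(w <- words (M.*2).+1) f w * q%:R ^- (M.*2).+1.
Proof.
have mcyl w : measurable (cylinder M (of_window M w) : set (borel (bisequence pi))).
  exact: measurable_cylinder.
have intc w : mu.-integrable setT
    (EFin \o (\1_(cylinder M (of_window M w)) : borel (bisequence pi) -> R)).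
  apply: (@bounded_integrable _ 1); first exact/measurable_indicP.
  by move=> s; rewrite indicE; case: (_ \in _); rewrite ?normr1 ?normr0.
have -> : (fun s => f (window M s)) = fun s : borel (bisequence pi) =>
    \sum_(w <- words (M.*2).+1) f w * \1_(cylinder M (of_window M w)) s.
  apply/funext => s.
  rewrite -(sum_words_indic (uniq_residues pi) (mem_residues absv_pi) f (size_window M s)).
  apply: eq_big_seq => w; rewrite (mem_words (mem_residues absv_pi)) => /eqP sw.
  rewrite indicE; congr (_ * _%:R); congr nat_of_bool; apply/eqP/idP.
    by move=> ws; apply/mem_set/window_eqP; rewrite window_of_window// ws.
  by move=> /set_mem /window_eqP; rewrite window_of_window.
have mucyl w : mu (cylinder M (of_window M w)) = (q%:R ^- (M.*2).+1)%:E.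
  by rewrite bernoulli mul2n addn1.
elim: (words _) => [|w l [ih1 ih2]].
  rewrite big_nil; split.
    rewrite (_ : _ \o _ = cst 0%E); first exact: integrable0.
    by apply/funext => s; rewrite /= big_nil.
  under eq_Rintegral do rewrite big_nil.
  by rewrite Rintegral_cst// mul0r.
have intZ : mu.-integrable setT (EFin \o (fun s : borel (bisequence pi) =>
    f w * \1_(cylinder M (of_window M w)) s)).
  exact: integrableZl (intc w).
rewrite big_cons; split.
  rewrite (_ : _ \o _ = (fun s : borel (bisequence pi) =>
      (f w * \1_(cylinder M (of_window M w)) s)%:E +
      (\sum_(w <- l) f w * \1_(cylinder M (of_window M w)) s)%:E)%E).
    exact: integrableD.
  by apply/funext => s; rewrite /= big_cons EFinD.
under eq_Rintegral do rewrite big_cons.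
rewrite RintegralD// ih2 RintegralZl//; congr (_ * _ + _).
by rewrite /Rintegral integral_indic// setIT; exact: (congr1 fine (mucyl w)).
Qed.

Lemma bernoulli_integral_approx M (f : borel (bisequence pi) -> R) (e : R) :
  mu.-integrable setT (EFin \o f) ->
  (forall s, `|f s - f (of_window M (window M s))| <= e) ->
  `|\int[mu]_s f s -
    \sum_(w <- words (M.*2).+1) f (of_window M w) * q%:R ^- (M.*2).+1| <= e.
Proof.
move=> intf fe; have [intg <-] := bernoulli_window_sum M (f \o of_window M).
rewrite -RintegralB//.
have intfg : mu.-integrable setT
    (EFin \o (fun s : borel (bisequence pi) => f s - (f \o of_window M) (window M s))).
  exact: (integrableB measurableT intf intg).
apply: (le_trans (le_normr_Rintegral _ _)) => //.
apply: le_trans (_ : \int[mu]_s e <= _).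
  apply: le_Rintegral => //; first exact: integrable_norm.
  by apply: (@bounded_integrable _ `|e|).
rewrite Rintegral_cst//; apply: le_trans (_ : e * 1 <= _); last by rewrite mulr1.
rewrite le_eqVlt; apply/orP; left; apply/eqP; congr (_ * _).
exact: (congr1 fine (probability_setT mu)).
Qed.

End bisequences.

(** * Equidistribution *)

(** Finitely many initial terms do not affect averages. The delay [k] is needed because a window
    centred at time [n] exists only for [n >= M]. *)
Lemma avg_cvg_approx_shift (R : realType) (u : nat -> R) (l : R) :
  (forall e, 0 < e -> exists k v m,
     [/\ forall n, `|u (n + k)%N - v n| <= e, `|l - m| <= e & avg_cvg v m]) ->
  avg_cvg u l.
Proof.
move=> approx; apply: avg_cvg_approx => e e0.
have [k [v [m [uv lm vm]]]] := approx e e0.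
exists (fun n => if (n < k)%N then u n else v (n - k)%N), m; split => //.
  move=> n; case: ltnP => nk; first by rewrite subrr normr0 ltW.
  by have := uv (n - k)%N; rewrite subnK.
apply/(avg_cvg_shift _ _ k); congr avg_cvg: vm; apply/funext => n.
by rewrite addnK ltnNge leq_addl.
Qed.

Lemma nth_past (F : eqType) (s : nat -> F) (x : F) n j : (j < n)%N ->
  nth x (past s n) j = s (n.-1 - j)%N.
Proof.
elim: n j => //= n ih [|j] jn /=; first by rewrite subn0.
by rewrite ih//; congr s; lia.
Qed.

Lemma walkN (R : realType) (F : eqType) (g : seq F -> F -> R) w :
  walk (fun t d => - g t d) w = - walk g w.
Proof. by elim: w => [|d t ih] /=; rewrite ?oppr0// ih opprD. Qed.

Lemma negligible_bigcup_count d (T : measurableType d) (R : realType)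
    (mu : {measure set T -> \bar R}) (I : countType) (A : I -> set T) :
  (forall i, mu.-negligible (A i)) -> mu.-negligible (\bigcup_i A i).
Proof.
move=> nA.
have -> : \bigcup_i A i = \bigcup_n (if choice.unpickle n is Some i then A i else set0).
  apply/seteqP; split=> [x [i _ Ai]|x [n _]].
    by exists (choice.pickle i) => //; rewrite choice.pickleK.
  by case: (choice.unpickle n) => // i Ai; exists i.
by apply: negligible_bigcup => n; case: (choice.unpickle n) => // ; exact: negligible_set0.
Qed.

Section equidistribution.
Context {R : realType} {K : nonArchLocalFieldType R} (pi : uniformizer K).
Variables a b : K.
Local Notation q := (residue_card pi).
Local Notation F := (residue_field pi).
Local Notation c := (q%:R^-1 : R).
Local Notation T := (T_map pi a b).
Local Notation square := (@integral_square R K).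
Local Notation words := (words (residues pi)).
Local Notation omega := (@omega R K pi a b).
Hypothesis absv_pi : absv (pi : K) = c.
Hypothesis absv_a : 0 < absv a < 1.
Hypothesis absv_b : absv b = q%:R.

(** By [omega_close] the map is continuous, so preimages of open sets are open. *)
Lemma measurable_omega :
  measurable_fun setT (omega : borel (bisequence pi) -> borel (plane K)).
Proof.
have borelE : @measurable _ (borel (plane K)) = <<s @open (plane K) >> by [].
apply: (measurability _ borelE) => _ [A openA <-]; rewrite setTI.
apply: sub_gen_smallest.
move: openA; rewrite !openE => openA s As.
have /nbhs_planeP[e e0 eA] := openA _ As.
have [M Me] := expr_lt_exists (inv_card_ge01 absv_pi) e0.
apply: filterS (nbhs_cylinder M s) => s' ss'.
have [h1 h2] := omega_close absv_pi absv_a absv_b (fun k kM => esym (ss' k kM)).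
by apply: eA; [exact: le_lt_trans h1 Me|exact: le_lt_trans h2 Me].
Qed.

Lemma continuous_measurable_plane (f : plane K -> R) : continuous f ->
  measurable_fun setT (f : borel (plane K) -> R).
Proof.
move=> cf; apply: (measurability _ (RGenOInfty.measurableE R)).
move=> _ [_ [x ->] <-]; rewrite setTI; apply: open_measurable_borel.
by apply: open_comp; [move=> p _; exact: cf|exact: interval_open].
Qed.

Variable mu_sigma : probability (borel (bisequence pi)) R.
Hypothesis bernoulli : uniform_bernoulli mu_sigma.

(** A continuous function may be unbounded on the plane, but [omega] takes values in the compact
    [R^2]. *)
Lemma integrable_omega (f : plane K -> R) : continuous f ->
  mu_sigma.-integrable setT (EFin \o (f \o omega : borel (bisequence pi) -> R)).
Proof.
move=> cf; have : compact (f @` box (1 : K)).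
  apply: continuous_compact; last exact: compact_box.
  exact: continuous_subspaceT.
move=> /compact_bounded[k [_ fk]].
apply: (@bounded_integrable _ _ _ _ _ (k + 1)).
  exact: (measurableT_comp (continuous_measurable_plane cf) measurable_omega).
move=> s; apply: (fk (k + 1)); first by rewrite ltrDl.
by exists (omega s) => //; rewrite box1; exact: omega_square.
Qed.

Lemma omega_unif (f : plane K -> R) (e : R) : continuous f -> 0 < e ->
  exists M, forall u v, square u -> plane_close (c ^+ M) u v ->
    `|f u - f v| <= e.
Proof.
move=> cf e0; have [d d0 dP] := box_unif_continuous 1 cf e0.
have [M Md] := expr_lt_exists (inv_card_ge01 absv_pi) d0; exists M => u v uS [h1 h2].
by apply: dP; rewrite ?box1//; split; apply: le_trans (ltW Md).
Qed.

Lemma normal_avg_cvg (f : plane K -> R) p : continuous f -> square p ->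
  (forall w d, avg_cvg (fun n =>
    digit_bias (residues pi) w d (past (digits pi a b p) n) (digits pi a b p n)
    : R) 0) ->
  avg_cvg (fun n => f (iter n T p)) (\int[mu_sigma]_s f (omega s)).
Proof.
move=> cf sp bias.
have E0 : (0 < size (residues pi))%N.
  by rewrite size_residues (ltn_trans _ (residue_card_gt1 absv_pi)).
have freq := normal_frequency bias.
apply: avg_cvg_approx_shift => e e0.
have [M MP] := omega_unif cf e0; set L := (M.*2).+1.
pose fw w := f (omega (of_window M w)).
set s := digits pi a b p.
(* These [L = 2M + 1] digits are those at times [n] to [n + 2M], centred at the approximated time
   [n + M]. *)
exists M, (fun n => fw (take L (past s (n + L)))),
  (\sum_(w <- words L) fw w * q%:R ^- L); split.
- move=> n; apply: MP; first exact: iter_T_square.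
  apply: iter_close_omega => // i iM; rewrite /of_window nth_take; last by rewrite /L; lia.
  rewrite nth_past; last by rewrite /L; lia.
  by rewrite -/(digits pi a b p _); congr digits; rewrite /L; lia.
- apply: bernoulli_integral_approx => //; first exact: integrable_omega.
  move=> s'; apply: MP; first exact: omega_square.
  apply: omega_close => //; apply/window_eqP => //.
  by rewrite window_of_window// size_window.
have -> : (fun n => fw (take L (past s (n + L)))) = fun n =>
    \sum_(w <- words L) fw w * matches w (past s (n + L)).
  apply/funext => n.
  have st : size (take L (past s (n + L))) = L.
    by rewrite size_takel// size_past leq_addl.
  rewrite -(sum_words_indic (uniq_residues pi) (mem_residues absv_pi) fw st).
  apply: eq_big_seq => w; rewrite (mem_words (mem_residues absv_pi)) => /eqP sw.
  by rewrite /matches sw eq_sym.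
have -> : \sum_(w <- words L) fw w * q%:R ^- L =
    \sum_(w <- words L) fw w * q%:R ^- size w.
  apply: eq_big_seq => w.
  by rewrite (mem_words (mem_residues absv_pi)) => /eqP ->.
apply: avg_cvg_sum => w; apply: avg_cvgZ.
by rewrite -size_residues; apply/(avg_cvg_shift (fun n => matches w (past s n))).
Qed.

Variable lambda : {measure set (borel (plane K)) -> \bar R}.
Hypothesis haar : haar_measure lambda.

(** Digits are recorded from a time [m] at which the orbit lies in [R^2], where it then stays, so
    [dig] never meets its default case. *)
Definition normal_basin : set (plane K) := [set p | exists2 m, square (iter m T p) &
  forall w d, avg_cvg (fun n => digit_bias (residues pi) w d
    (past (digits pi a b (iter m T p)) n) (digits pi a b (iter m T p) n) : R) 0].

Lemma normal_basin_sub : normal_basin `<=` basin pi a b.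
Proof.
move=> p [m sm _]; exists m.+1 => //.
exact: (T_map_square absv_pi absv_a absv_b sm).
Qed.

Lemma negligible_abnormal : lambda.-negligible (basin pi a b `\` normal_basin).
Proof.
have allE := mem_residues absv_pi.
have E0 : (0 < size (residues pi))%N.
  by rewrite size_residues (ltn_trans _ (residue_card_gt1 absv_pi)).
pose g (w : seq F) (d : F) (pos : bool) : seq F -> F -> R := fun t d' =>
  if pos then digit_bias (residues pi) w d t d' else - digit_bias (residues pi) w d t d'.
(* Coding digits by natural numbers makes the index type of the union below countable; [pos] selects
   the sign of the deviation and [j] the threshold [1/(j+1)]. *)
pose z (n : nat) : F := nth 0 (residues pi) n.
pose A (i : nat * seq nat * nat * bool * nat) : set (borel (plane K)) :=
  let: (m, w, d, pos, j) := i in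
  [set p | square (iter m T p) /\ forall n, exists2 N, (n <= N)%N &
     j.+1%:R^-1 * N%:R <= walk (g (map z w) (z d) pos)
       (past (digits pi a b (iter m T p)) N)].
have z_surj d : exists n, z n = d.
  by exists (index d (residues pi)); rewrite /z nth_index.
have nA : lambda.-negligible (\bigcup_i A i).
  apply: negligible_bigcup_count => -[[[[m w] d] pos] j].
  apply: null_walk_ge => //.
  - move=> t; rewrite /g; case: pos; last rewrite sumrN;
    by rewrite sum_digit_bias ?oppr0// ?uniq_residues.
  - move=> t d'; rewrite /g; case: pos; rewrite ?normrN; exact: digit_bias_le1.
  - have j1 : (j.+1%:R^-1 : R) <= 1 by rewrite invf_le1 ?ltr0Sn// ler1n.
    by rewrite invr_gt0 ltr0Sn (le_trans j1)// ler1n.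
apply: negligibleS nA => p [[m _ sm] np].
apply: contrapT => nA; apply: np; exists m => // w d.
have [n nd] := z_surj d.
have [w' ww'] : exists w', map z w' = w.
  exists [seq index d (residues pi) | d <- w]; rewrite -map_comp.
  by rewrite -[RHS]map_id; apply: eq_map => d'; rewrite /= /z nth_index.
have bound pos (j : nat) : \forall N \near \oo,
    walk (g w d pos) (past (digits pi a b (iter m T p)) N) <= j.+1%:R^-1 * N%:R.
  have nAi : ~ A (m, w', n, pos, j) p by move=> Ai; apply: nA; exists (m, w', n, pos, j).
  rewrite /A /= ww' nd in nAi.
  apply: contrapT => h; apply: nAi; split => // n0.
  apply: contrapT => h'; apply: h; exists n0 => // N /= nN.
  rewrite leNgt; apply/negP => lt; apply: h'; exists N => //; exact: ltW.
apply/cvgrPdist_le => e e0.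
have [j je] : exists j : nat, j.+1%:R^-1 <= e.
  have := @cvg_harmonic R => /cvgr0Pnorm_le /(_ _ e0) [j _ /(_ j (leqnn _))].
  by rewrite /= ger0_norm// => h; exists j.
near=> N.
have N0 : 0 < N%:R :> R by rewrite ltr0n; near: N; exact: nbhs_infty_gt.
have h1 : walk (g w d true) (past (digits pi a b (iter m T p)) N) <= j.+1%:R^-1 * N%:R.
  by near: N; exact: bound.
have h2 : walk (g w d false) (past (digits pi a b (iter m T p)) N) <= j.+1%:R^-1 * N%:R.
  by near: N; exact: bound.
rewrite /g walkN in h2; rewrite /g in h1.
rewrite sub0r normrN -walk_past normrM gtr0_norm ?invr_gt0// mulrC ler_pdivrMr//.
apply: le_trans (_ : j.+1%:R^-1 * N%:R <= _); last by rewrite ler_wpM2r// ltW.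
by rewrite ler_norml h1 andbT lerNl.
Unshelve. all: by end_near. Qed.

End equidistribution.

Theorem theorem2 (R : realType) (K : nonArchLocalFieldType R)
  (pi : uniformizer K) (a b : K)
  (lambda : {measure set (borel (plane K)) -> \bar R})
  (mu_sigma : probability (borel (bisequence pi)) R) :
  absv (pi : K) = (residue_card pi)%:R^-1 ->
  0 < absv a < 1 ->
  absv b = (residue_card pi)%:R ->
  haar_measure lambda ->
  uniform_bernoulli mu_sigma ->
  exists mu_T : probability (borel (plane K)) R,
    [/\ forall A : set (borel (plane K)), measurable A ->
          mu_T A = mu_sigma (omega a b @^-1` A),
        exists G : set (borel (plane K)),
          [/\ G `<=` basin pi a b,
              lambda.-negligible (basin pi a b `\` G) &
              forall p : plane K, G p ->
                equidistributed mu_T (T_map pi a b) p] &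
        physical_measure lambda mu_T (T_map pi a b)].
Proof.
move=> absv_pi absv_a absv_b haar bernoulli.
have momega := measurable_omega absv_pi absv_a absv_b.
have [X XE] : exists X : {mfun borel (bisequence pi) >-> borel (plane K)},
    X = omega a b :> (bisequence pi -> plane K).
  by exists (mfun_Sub (mem_set momega)).
pose mu_T : probability (borel (plane K)) R := distribution mu_sigma X.
have mu_TE (A : set (borel (plane K))) : mu_T A = mu_sigma (omega a b @^-1` A).
  by rewrite -XE.
have equi p : normal_basin pi a b p -> equidistributed mu_T (T_map pi a b) p.
  move=> [m sm bias] f cf.
  have mf := continuous_measurable_plane cf.
  have intf := integrable_omega absv_pi absv_a absv_b mu_sigma cf.
  have intX : mu_sigma.-integrable (X @^-1` setT) ((EFin \o f) \o X).
    by rewrite preimage_setT XE.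
  have mEf : measurable_fun setT (EFin \o (f : borel (plane K) -> R)).
    exact/measurable_EFinP.
  split; first exact: integrable_pushforward.
  have -> : \int[mu_T]_x f x = \int[mu_sigma]_s f (omega a b s).
    rewrite /Rintegral; congr fine.
    rewrite [LHS](integral_pushforward _ mEf intX)//.
    by rewrite preimage_setT XE.
  (* The first [m] iterates, possibly outside [R^2], do not influence the average. *)
  apply/(avg_cvg_shift (fun n => f (iter n (T_map pi a b) p)) _ m).
  have := normal_avg_cvg absv_pi absv_a absv_b bernoulli cf sm bias.
  by congr avg_cvg; apply/funext => n; rewrite iterD.
have neg := negligible_abnormal absv_pi absv_a absv_b haar.
exists mu_T; split => //.
  exists (normal_basin pi a b); split => //.
  exact: normal_basin_sub.
split.
  move=> A mA; rewrite !mu_TE.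
  have mB : measurable (omega a b @^-1` A : set (borel (bisequence pi))).
    by rewrite -[X in measurable X]setTI; exact: momega.
  rewrite -(bernoulli_shift absv_pi bernoulli mB); congr (mu_sigma _).
  apply/seteqP; split=> s /=; by rewrite /shift (omega_shift absv_pi absv_a absv_b).
have [N [mN N0 subN]] := neg.
have mbox := measurable_box (oner_neq0 K).
(* Removing a measurable null cover of the exceptional set makes the set measurable; it keeps the
   positive measure of the box, which lies in the basin. *)
exists (box (1 : K) `\` N); split.
- exact: measurableD.
- rewrite lt0e measure_ge0 andbT; apply/eqP => h.
  have := haar_box1_gt0 absv_pi haar; rewrite ltNge => /negP; apply.
  apply: (@le_trans _ _ (lambda ((box (1 : K) `\` N) `|` N))).
    apply: le_measure; rewrite ?inE//; first by apply: measurableU => //; exact: measurableD.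
    by move=> p bp; have [Np|Np] := pselect (N p); [right|left].
  apply: (le_trans (measureU2 _ _ _)) => //; first exact: measurableD.
  by rewrite [X in (X + _)%E]h [X in (_ + X)%E]N0 adde0.
- move=> p [bp Np]; apply: equi; apply: contrapT => np; apply: Np; apply: subN.
  split => //; exists 1 => //=.
  by apply: T_map_square => //; rewrite -box1.
Qed.
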